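(* In the setting of the context, suppose that: (1) $f$, $g\circ T$ and $h$ belong to $\Gamma_0(\mathcal H_p)$; (2) the pair $(f,\mathcal C)$ is $(F,\zeta)$-smooth for some $F:\mathcal H_p\to\mathbb R\cup\{+\infty\}$ and $\zeta:]0,1]\to\mathbb R_+$; (3) $\mathcal C=\mathrm{dom}(h)$ is weakly compact; (4) $T\mathcal C\subset \mathrm{dom}(\partial g)$ and $\sup_{x\in\mathcal C}\|[\partial g(Tx)]^0\|<\infty$; (5) there exists a saddle point $(x^\star,\mu^\star)\in\mathcal H_p\times\mathcal H_d$ of $\mathcal L$. Suppose the parameters satisfy: (6) $(\gamma_k)\subset\,]0,1]$ and the sequences $(\zeta(\gamma_k))_k$, $(\gamma_k^2/\beta_k)_k$, $(\gamma_k\beta_k)_k$ belong to $\ell^1_+$; (7) $(\gamma_k)_k\notin\ell^1$; (8) $(\beta_k)_k$ is non-increasing and converges to $0$; (9) $(\rho_k)_k$ is non-decreasing with $0<\underline\rho=\inf_k\rho_k\le\sup_k\rho_k=\overline\rho<+\infty$; (10) for some positive constants $\underline M_\gamma,\overline M_\gamma$, $\underline M_\gamma\le\inf_k(\gamma_k/\gamma_{k+1})\le\sup_k(\gamma_k/\gamma_{k+1})\le\overline M_\gamma$; (11) $\theta_k=\gamma_k/c$ for all $k\in\mathbb N$, for some $c>0$ such that $\overline M_\gamma/c-\underline\rho/2<0$. Let $(x_k)_{k\in\mathbb N}$ be the sequence generated by the algorithm in the context, and let $\Gamma_k=\sum_{i=0}^k\gamma_i$. Then: (i) $Ax_k$ converges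 strongly to $b$ as $k\to\infty$. (ii) $\inf_{0\le i\le k}\|Ax_i-b\|=O\big(1/\sqrt{\Gamma_k}\big)$, and there exists a subsequence $(x_{k_j})_{j\in\mathbb N}$ such that for all $j\in\mathbb N$, $\|Ax_{k_j}-b\|\le 1/\sqrt{\Gamma_{k_j}}$. (iii) With $\bar x_k=\sum_{i=0}^k\gamma_ix_i/\Gamma_k$ for each $k\in\mathbb N$, $\|A\bar x_k-b\|=O\big(1/\sqrt{\Gamma_k}\big)$.
   Context: Setting. $\mathcal H_p,\mathcal H_d,\mathcal H_v$ are real Hilbert spaces, $A:\mathcal H_p\to\mathcal H_d$ and $T:\mathcal H_p\to\mathcal H_v$ are bounded linear operators, $b\in\mathcal H_d$, and $f,h:\mathcal H_p\to\mathbb R\cup\{+\infty\}$, $g:\mathcal H_v\to\mathbb R\cup\{+\infty\}$ are proper, convex, lower semicontinuous, with $\mathcal C:=\mathrm{dom}(h)$ weakly compact. The problem is $\min_{x\in\mathcal H_p}\{f(x)+g(Tx)+h(x):Ax=b\}$. $\Gamma_0(\mathcal H)$ is the set of proper convex lower semicontinuous functions $\mathcal H\to\mathbb R\cup\{+\infty\}$. Lagrangian: $\mathcal L(x,\mu)=f(x)+g(Tx)+h(x)+\langle\mu,Ax-b\rangle$; $(x^\star,\mu^\star)$ is a saddle point if $\mathcal L(x^\star,\mu)\le\mathcal L(x^\star,\mu^\star)\le\mathcal L(x,\mu^\star)$ for all $(x,\mu)$. For $x\in\mathrm{dom}(\partial g)=\{x:\partial g(x)\ne\emptyset\}$, $[\partial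 g(x)]^0$ is the element of minimal norm of the subdifferential $\partial g(x)$. $(G,\zeta)$-smoothness: Let $G:\mathcal H\to\mathbb R\cup\{+\infty\}$ and $\zeta:]0,1]\to\mathbb R_+$. A pair $(q,\mathcal C)$ with $q:\mathcal H\to\mathbb R\cup\{+\infty\}$ and $\mathcal C\subset\mathrm{dom}(q)$ is $(G,\zeta)$-smooth if there is an open set $\mathcal C_0$ with $\mathcal C\subset\mathcal C_0\subset\mathrm{int}(\mathrm{dom}(G))$ such that $G$ and $q$ are differentiable on $\mathcal C_0$, $G-q$ is convex on $\mathcal C_0$, and $K_{(G,\zeta,\mathcal C)}:=\sup\{D_G(z,x)/\zeta(\gamma): x,s\in\mathcal C,\ \gamma\in]0,1],\ z=x+\gamma(s-x)\}<+\infty$, where $D_G(z,x)=G(z)-G(x)-\langle\nabla G(x),z-x\rangle$. Algorithm. Given $x_0\in\mathcal C$, $\mu_0\in\mathrm{ran}(A)$ and non-negative real sequences $(\gamma_k),(\beta_k),(\theta_k),(\rho_k)$ (with $\beta_k>0$), iterate for $k=0,1,2,\dots$: $y_k=\mathrm{prox}_{\beta_kg}(Tx_k)$; $z_k=\nabla f(x_k)+T^*(Tx_k-y_k)/\beta_k+A^*\mu_k+\rho_kA^*(Ax_k-b)$; $s_k\in\mathrm{Argmin}_{s\in\mathcal H_p}\{h(s)+\langle z_k,s\rangle\}$; $x_{k+1}=x_k-\gamma_k(x_k-s_k)$; $\mu_{k+1}=\mu_k+\theta_k(Ax_{k+1}-b)$. Here $\mathrm{prox}_{q}(x)=\mathrm{argmin}_y\{q(y)+\frac12\|x-y\|^2\}$.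 $\ell^1$ is the space of absolutely summable real sequences and $\ell^1_+$ the set of its non-negative elements. $\mathbb N=\{0,1,2,\dots\}$. *)

(* Defs.v *)
From HB Require Import structures.
From mathcomp Require Import all_boot all_order all_algebra.
From mathcomp Require Import sesquilinear.
From mathcomp Require Import all_classical all_reals all_analysis.

Set Implicit Arguments.
Unset Strict Implicit.
Unset Printing Implicit Defensive.
Import Order.TTheory GRing.Theory Num.Theory.
Import numFieldNormedType.Exports.

Local Open Scope classical_set_scope.
Local Open Scope ring_scope.

HB.mixin Record isHilbert (R : realType) V of CompleteNormedModule R V := {
  inner : {dot V for @idfun R};
  inner_norm : forall x : V, inner x x = `|x| ^+ 2
}.

#[short(type="hilbertType")]
HB.structure Definition Hilbert (R : realType) :=
  {V of isHilbert R V & CompleteNormedModule R V}.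

Section weak_topology.
Context {R : realType} (H : hilbertType R).

(* The coarsest topology making every x |-> <x, u> continuous: the initial
   topology of x |-> (u |-> <x, u>) into the pointwise topology. *)
Definition weak : Type :=
  initial_topology ((fun x u => inner x u) : H -> {ptws H -> R}).

HB.instance Definition _ := Topological.on weak.

Definition weakly_compact (C : set H) : Prop := compact (C : set weak).

End weak_topology.

(* Functions H -> R \cup {+oo} are maps f : H -> \bar R that avoid -oo. *)
Section convex_analysis.
Context {R : realType} {H : hilbertType R}.
Implicit Types (f q G : H -> \bar R) (x y z : H).
Local Open Scope ereal_scope.

Definition edom f : set H := [set x | f x < +oo].

Definition eproper f : Prop := (forall x, -oo < f x) /\ edom f !=set0.

Definition econvex f : Prop := forall x y (t : R), (0 < t < 1)%R ->
  f (t *: x + (1 - t) *: y)%R <= t%:E * f x + (1 - t)%:E * f y.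

Definition Gamma0 f : Prop :=
  [/\ eproper f, econvex f & lower_semicontinuous f].

Definition subdifferential f x : set H :=
  [set u | forall y, f x + (inner u (y - x)%R)%:E <= f y].

Definition dom_subdifferential f : set H :=
  [set x | subdifferential f x !=set0].

(* The element of minimal norm; [get] picks it, when it exists. *)
Definition min_norm (S : set H) : H :=
  get [set u | S u /\ forall v, S v -> (`|u| <= `|v|)%R].

Definition Argmin f : set H := [set x | forall y, f x <= f y].

Definition prox q x : set H :=
  Argmin (fun y => q y + (2^-1 * `|x - y| ^+ 2)%:E).

(* Frechet differentiability; it presupposes that f is finite near x. *)
Definition edifferentiable f x : Prop :=
  (\forall y \near x, f y \is a fin_num) /\ differentiable (fine \o f) x.

(* The Riesz representative of the differential. *)
Definition gradient f x : H :=
  get [set u | forall v, inner u v = 'd (fine \o f) x v].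

Definition bregman G z x : \bar R :=
  G z - G x - (inner (gradient G x) (z - x)%R)%:E.

(* The quotient is that of \bar R: for zeta gamma = 0 it is +oo when the
   numerator is positive and 0 when it vanishes. *)
Definition smooth_const G (zeta : R -> R) (C : set H) : \bar R :=
  ereal_sup [set r | exists x s (gamma : R),
    [/\ C x, C s, (0 < gamma <= 1)%R &
        r = bregman G (x + gamma *: (s - x))%R x / (zeta gamma)%:E]].

(* C0 need not be convex: convexity of G - q on C0 is convexity on each convex
   subset of C0, i.e. along each segment contained in C0. *)
Definition smooth_pair G (zeta : R -> R) q (C : set H) : Prop :=
  C `<=` edom q /\
  exists C0 : set H,
    [/\ open C0, C `<=` C0 /\ C0 `<=` (edom G)°,
        forall x, C0 x -> edifferentiable G x /\ edifferentiable q x,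
        forall D : set (convex_lmodType H), convex_set D -> D `<=` C0 ->
          convex_function D (fun x => fine (G x) - fine (q x))%R
      & smooth_const G zeta C < +oo].

End convex_analysis.

Definition adjoint {R : realType} {H K : hilbertType R} (A : H -> K) (v : K) : H :=
  get [set u | forall x, inner x u = inner (A x) v].

Definition ell1 {R : realType} (u : R^nat) : Prop := cvgn [normed series u].

Definition ell1_plus {R : realType} (u : R^nat) : Prop :=
  (forall k, 0 <= u k) /\ ell1 u.

Section problem.
Context {R : realType} {Hp Hd Hv : hilbertType R}.
Variables (f h : Hp -> \bar R) (g : Hv -> \bar R).
Variables (A : Hp -> Hd) (T : Hp -> Hv) (b : Hd).

Definition Lagrangian (x : Hp) (mu : Hd) : \bar R :=
  (f x + g (T x) + h x + (inner mu (A x - b)%R)%:E)%E.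

Definition saddle_point (xs : Hp) (mus : Hd) : Prop :=
  forall x mu, (Lagrangian xs mu <= Lagrangian xs mus)%E /\
               (Lagrangian xs mus <= Lagrangian x mus)%E.

Definition algorithm (gamma beta theta rho : R^nat)
    (x : nat -> Hp) (mu : nat -> Hd)
    (y : nat -> Hv) (z s : nat -> Hp) : Prop :=
  [/\ edom h (x 0%N), range A (mu 0%N) & forall k,
    [/\ prox (fun v => (beta k)%:E * g v)%E (T (x k)) (y k),
        z k = gradient f (x k) + (beta k)^-1 *: adjoint T (T (x k) - y k)
              + adjoint A (mu k) + rho k *: adjoint A (A (x k) - b),
        Argmin (fun v => h v + (inner (z k) v)%:E)%E (s k),
        x k.+1 = x k - gamma k *: (x k - s k)
      & mu k.+1 = mu k + theta k *: (A (x k.+1) - b)]].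

End problem.

Definition psum {R : realType} (gamma : R^nat) (k : nat) : R :=
  \sum_(0 <= i < k.+1) gamma i.

Definition ergodic {R : realType} {H : hilbertType R} (gamma : R^nat)
    (x : nat -> H) (k : nat) : H :=
  (psum gamma k)^-1 *: \sum_(0 <= i < k.+1) gamma i *: x i.

(* Main.v *)
Require Import Defs.
From mathcomp Require Import all_boot all_order all_algebra.
From mathcomp Require Import all_classical all_reals all_analysis.
From mathcomp Require Import sesquilinear ring lra.

Set Implicit Arguments.
Unset Strict Implicit.
Unset Printing Implicit Defensive.
Import Order.TTheory GRing.Theory Num.Theory.
Import numFieldNormedType.Exports.

Local Open Scope classical_set_scope.
Local Open Scope ring_scope.

(* Compare the iterates with x* alone, through the Lyapunov function
     U_k = E_k - Phi* + (c / 2) |mu_k - mu*|^2 + correction terms,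
     E_k = f(x_k) + g^{beta_k}(T x_k) + h(x_k) + <mu_k, e_k> + (rho_k / 2) |e_k|^2,
   where e_k = A x_k - b, Phi = f + g o T + h, Phi* is the value of Phi at x*, and g^beta is the
   Moreau envelope of g. The descent lemma, the
   optimality of s_k against x* and the saddle point inequality
   Phi(x_k) - Phi* >= - <mu*, e_k> give, to first order in gamma_k,
     E_{k+1} - E_k <= - gamma_k <mu_k - mu*, e_k> - gamma_k rho_k |e_k|^2
                      + theta_k |e_{k+1}|^2,
   and since theta_k = gamma_k / c the first term on the right is cancelled by
   the increment of (c / 2) |mu_k - mu*|^2. As Mhi >= 1 forces
   rho_k - 1 / c > 0, this yields a quasi-Fejer inequality
     U_{k+1} + delta gamma_k |e_k|^2 <= (1 + w_k) U_k  with (w_k) summable,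
   hence sum_k gamma_k |e_k|^2 < +oo, from which the three claims follow. *)

(** * Hilbert spaces *)

Section inner_product.
Context {R : realType} {H : hilbertType R}.
Implicit Types (x y z : H) (a : R).

Lemma innerC x y : inner x y = inner y x.
Proof. by have := hermC (@inner R H) x y; rewrite expr0 mul1r. Qed.

Lemma innerDl x y z : inner (x + y) z = inner x z + inner y z.
Proof. exact: linearDl. Qed.

Lemma innerDr x y z : inner z (x + y) = inner z x + inner z y.
Proof. by rewrite innerC innerDl !(innerC z). Qed.

Lemma innerZl a x y : inner (a *: x) y = a * inner x y.
Proof. exact: linearZl_LR. Qed.

Lemma innerZr a x y : inner x (a *: y) = a * inner x y.
Proof. by rewrite innerC innerZl innerC. Qed.

Lemma innerNl x y : inner (- x) y = - inner x y.
Proof. by rewrite -scaleN1r innerZl mulN1r. Qed.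

Lemma innerNr x y : inner x (- y) = - inner x y.
Proof. by rewrite innerC innerNl innerC. Qed.

Lemma innerBl x y z : inner (x - y) z = inner x z - inner y z.
Proof. by rewrite innerDl innerNl. Qed.

Lemma innerBr x y z : inner z (x - y) = inner z x - inner z y.
Proof. by rewrite innerDr innerNr. Qed.

Lemma sqr_normD x y : `|x + y| ^+ 2 = `|x| ^+ 2 + 2 * inner x y + `|y| ^+ 2.
Proof.
rewrite -!inner_norm innerDl !innerDr (innerC y x); ring.
Qed.

Lemma sqr_normB x y : `|x - y| ^+ 2 = `|x| ^+ 2 - 2 * inner x y + `|y| ^+ 2.
Proof. by rewrite sqr_normD innerNr normrN mulrN. Qed.

Lemma sqr_normZ a x : `|a *: x| ^+ 2 = a ^+ 2 * `|x| ^+ 2.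
Proof. by rewrite -!inner_norm innerZl innerZr mulrA. Qed.

(** Expand |t x - y|^2 >= 0 and divide by 2 t. The free weight [t] is tuned at each use. *)
Lemma inner_young (t : R) x y : 0 < t ->
  inner x y <= t / 2 * `|x| ^+ 2 + (2 * t)^-1 * `|y| ^+ 2.
Proof.
move=> t0; have := sqr_ge0 `|t *: x - y|.
rewrite sqr_normB sqr_normZ innerZl => h.
have -> : t / 2 * `|x| ^+ 2 + (2 * t)^-1 * `|y| ^+ 2 =
   (2 * t)^-1 * (t ^+ 2 * `|x| ^+ 2 - 2 * (t * inner x y) + `|y| ^+ 2)
     + inner x y.
  by field; rewrite gt_eqF.
by rewrite lerDr mulr_ge0// invr_ge0 mulr_ge0// ltW.
Qed.

Lemma inner_le x y : inner x y <= `|x| * `|y|.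
Proof.
have [->|x0] := eqVneq x 0; first by rewrite -(scale0r 0) innerZl scale0r normr0 !mul0r.
have [->|y0] := eqVneq y 0.
  by rewrite -(scale0r 0) innerZr scale0r normr0 mul0r mulr0.
have nx : 0 < `|x| by rewrite normr_gt0.
have ny : 0 < `|y| by rewrite normr_gt0.
(* The weight |y| / |x| makes both terms equal to |x| |y| / 2. *)
apply: le_trans (inner_young x y (divr_gt0 ny nx)) _.
by rewrite le_eqVlt; apply/orP; left; apply/eqP; field; rewrite !gt_eqF.
Qed.

Lemma norm_inner_le x y : `|inner x y| <= `|x| * `|y|.
Proof.
rewrite ler_norml inner_le andbT lerNl.
by rewrite -innerNl (le_trans (inner_le _ _))// normrN.
Qed.

Lemma inner_continuous y : continuous (fun x => inner x y).
Proof.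
move=> x; apply/cvgrPdist_lt => e e0.
have y1 : 0 < `|y| + 1 by rewrite ltr_wpDl.
have /cvgrPdist_lt/(_ _ (divr_gt0 e0 y1)) := @cvg_id _ (nbhs x).
apply: filterS => z; rewrite ltr_pdivlMr// -innerBl; apply: le_lt_trans.
by apply: le_trans (norm_inner_le _ _) _; rewrite ler_wpM2l// lerDl.
Qed.

Lemma parallelogram x y :
  `|x - y| ^+ 2 = 2 * `|x| ^+ 2 + 2 * `|y| ^+ 2 - 4 * `|2^-1 *: (x + y)| ^+ 2.
Proof. by rewrite sqr_normB sqr_normZ sqr_normD; field. Qed.

(* A sequence of approximate minimisers is Cauchy by the parallelogram law. *)
Lemma ex_min_norm (S : set H) : S !=set0 -> closed S ->
  (forall x y, S x -> S y -> S (2^-1 *: (x + y))) ->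
  exists2 u, S u & forall v, S v -> `|u| <= `|v|.
Proof.
move=> [w0 Sw0] clS midS.
pose N := [set `|v| | v in S].
have N0 : N !=set0 by exists `|w0|, w0.
have lbN : lbound N 0 by move=> _ [v _ <-].
have hN : has_inf N by split=> //; exists 0.
pose d := inf N.
have d0 : 0 <= d by apply: lb_le_inf.
have dle v : S v -> d <= `|v| by move=> Sv; apply: ge_inf; [exists 0|exists v].
have ex n : exists v, S v /\ `|v| < d + n.+1%:R^-1.
  have e0 : 0 < n.+1%:R^-1 :> R by rewrite invr_gt0.
  by have [_ [v Sv <-] lt] := inf_adherent e0 hN; exists v.
have [w hw] := choice ex.
(* Each squared norm is at most d^2 + (2 d + 1) eps with eps = 1 / (n + 1), as eps^2 <= eps, and the
   midpoint has norm at least d, so the d^2 terms cancel in [parallelogram]. *)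
have dist i j n : (n <= i)%N -> (n <= j)%N ->
    `|w i - w j| ^+ 2 <= 4 * (2 * d + 1) * n.+1%:R^-1.
  move=> ni nj; rewrite parallelogram.
  have step k : (n <= k)%N -> `|w k| ^+ 2 <= d ^+ 2 + (2 * d + 1) * n.+1%:R^-1.
    move=> nk; have [_ /ltW lek] := hw k.
    have kn : k.+1%:R^-1 <= n.+1%:R^-1 :> R by rewrite lef_pV2 ?posrE// ler_nat.
    have e0 : 0 <= n.+1%:R^-1 :> R by rewrite invr_ge0.
    have e1 : n.+1%:R^-1 <= 1 :> R by rewrite invf_le1 ?ler1n.
    have {}lek : `|w k| <= d + n.+1%:R^-1 by apply: le_trans lek _; rewrite lerD2l.
    have : `|w k| ^+ 2 <= (d + n.+1%:R^-1) ^+ 2.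
      by rewrite ler_sqr ?nnegrE// addr_ge0.
    have : n.+1%:R^-1 ^+ 2 <= n.+1%:R^-1 :> R by rewrite expr2 ler_piMl.
    move: (n.+1%:R^-1) => e; lra.
  have := step _ ni; have := step _ nj.
  have : d ^+ 2 <= `|2^-1 *: (w i + w j)| ^+ 2.
    by rewrite ler_sqr ?nnegrE// dle//; apply: midS; [case: (hw i)|case: (hw j)].
  move: (n.+1%:R^-1) => e; lra.
have cw : cvgn w.
  apply/cauchy_cvgP/cauchy_ballP => e e0.
  have c0 : 0 < 4 * (2 * d + 1) by lra.
  have [n hn] : exists n, 4 * (2 * d + 1) * n.+1%:R^-1 < e ^+ 2.
    have e2 : 0 < e ^+ 2 / (4 * (2 * d + 1)) by rewrite divr_gt0// exprn_gt0.
    near \oo => n; exists n.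
    rewrite mulrC -ltr_pdivlMr//; near: n.
    exact: near_infty_natSinv_lt (PosNum e2).
  exists (w @` [set k | (n <= k)%N], w @` [set k | (n <= k)%N]) => /=.
    by split; exists n => // k nk; exists k.
  move=> [_ _] /= [[i ni <-] [j nj <-]]; rewrite -ball_normE /=.
  rewrite -ltr_sqr ?nnegrE ?normr_ge0 ?(ltW e0)//.
  exact: le_lt_trans (dist _ _ _ ni nj) hn.
exists (lim (w @ \oo)).
  by apply: (@closed_cvg _ _ _ _ w S clS _ _ cw); apply: nearW => k; case: (hw k).
move=> v Sv; apply: le_trans (dle _ Sv).
have cn : `|w k| @[k --> \oo] --> `|lim (w @ \oo)| by apply: cvg_norm.
have cd : (d + k.+1%:R^-1) @[k --> \oo] --> d.
  rewrite -[X in _ --> X]addr0; apply: cvgD; first exact: cvg_cst.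
  exact: cvg_harmonic.
apply: ler_cvg_to cn cd _.
by apply: nearW => k; have [_ /ltW] := hw k.
Unshelve. all: by end_near.
Qed.

(* The element of minimal norm of the affine hyperplane {phi = 1} is
   orthogonal to the kernel of phi. *)
Lemma riesz (phi : H -> R) : continuous phi ->
  (forall x y, phi (x + y) = phi x + phi y) ->
  (forall a x, phi (a *: x) = a * phi x) ->
  exists u, forall v, inner u v = phi v.
Proof.
move=> cphi phiD phiZ.
have [ph0|/existsNP[w /eqP phw]] := pselect (forall x, phi x = 0).
  by exists 0 => v; rewrite ph0 -(scale0r 0) innerZl mul0r.
have [|||u phu umin] := @ex_min_norm [set x | phi x = 1].
- by exists ((phi w)^-1 *: w); rewrite /= phiZ mulVf.
- rewrite (_ : [set x | _] = phi @^-1` [set 1])//.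
  by apply: closed_comp; [move=> *; exact: cphi|exact: closed_eq].
- by move=> x y /= hx hy; rewrite phiZ phiD hx hy; field.
have ker v : phi v = 0 -> inner u v = 0.
  move=> pv.
  have key t : 0 <= 2 * (t * inner u v) + t ^+ 2 * `|v| ^+ 2.
    have : `|u| <= `|u + t *: v|.
      by apply: umin; rewrite /= phiD phiZ pv phu mulr0 addr0.
    rewrite -ler_sqr ?nnegrE// sqr_normD innerZr sqr_normZ; lra.
  apply/eqP; rewrite -sqrf_eq0; apply/eqP; apply/le_anti; rewrite sqr_ge0 andbT.
  have n0 : 0 < `|v| ^+ 2 + 1 by have := sqr_ge0 `|v|; lra.
  (* The quadratic in [key] is minimal for the denominator |v|^2; adding 1 covers v = 0 and still
     yields - <u, v>^2 (|v|^2 + 2) >= 0. *)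
  have := key (- inner u v / (`|v| ^+ 2 + 1)).
  set N := `|v| ^+ 2 in n0 *; set a := inner u v => h.
  have : 0 <= (N + 1) ^+ 2 * (2 * (- a / (N + 1) * a) + (- a / (N + 1)) ^+ 2 * N).
    by rewrite mulr_ge0// sqr_ge0.
  rewrite (_ : (N + 1) ^+ 2 * _ = - (a ^+ 2 * (N + 2))); last by field; rewrite gt_eqF.
  have N0 : 0 <= N by exact: sqr_ge0.
  have := sqr_ge0 a; nra.
have u0 : `|u| ^+ 2 != 0.
  rewrite sqrf_eq0 normr_eq0; apply/eqP => uE.
  by move: phu; rewrite uE /= -(scale0r 0) phiZ mul0r => /esym/eqP; rewrite oner_eq0.
exists ((`|u| ^+ 2)^-1 *: u) => v.
have : inner u (v - phi v *: u) = 0.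
  by apply: ker; rewrite phiD -scaleNr phiZ phu mulr1 subrr.
rewrite innerBr innerZr inner_norm => /eqP; rewrite subr_eq0 => /eqP h.
by rewrite innerZl h mulrCA mulVf ?mulr1.
Qed.

End inner_product.

(** * Gradients, adjoints and weakly compact sets *)

Section hilbert_operators.
Context {R : realType}.

(** [gradient] is defined by [get], which is meaningful only if a representative exists; [riesz]
    supplies one. [adjointP] follows the same pattern. *)
Lemma gradientP (H : hilbertType R) (f : H -> \bar R) (x v : H) :
  differentiable (fine \o f) x ->
  inner (gradient f x) v = 'd (fine \o f) x v.
Proof.
move=> df; have [|||u hu] := @riesz R H ('d (fine \o f) x).
- exact: diff_continuous.
- by move=> y z; rewrite linearD.
- by move=> a y; rewrite linearZ.
by apply: (@getPex _ [set u | forall v, inner u v = 'd (fine \o f) x v]); exists u.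
Qed.

Lemma adjointP (H K : hilbertType R) (A : {linear H -> K}) (x : H) (v : K) :
  continuous A -> inner x (adjoint A v) = inner (A x) v.
Proof.
move=> cA; have [|||u hu] := @riesz R H (fun x => inner (A x) v).
- move=> y; apply: (@continuous_comp _ _ _ A (fun w => inner w v)); first exact: cA.
  exact: inner_continuous.
- by move=> y z; rewrite linearD innerDl.
- by move=> a y; rewrite linearZ innerZl.
apply: (@getPex _ [set u | forall x, inner x u = inner (A x) v]).
by exists u => y; rewrite innerC hu.
Qed.

Lemma continuous_linear_bound (H K : hilbertType R) (A : {linear H -> K}) :
  bounded_near A (nbhs (0 : H)) -> exists2 L, 0 <= L & forall x, `|A x| <= L * `|x|.
Proof.
move=> /linear_boundedP[M [_ hM]]; exists (Num.max 0 (M + 1)).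
  by rewrite le_max lexx.
by apply: hM; rewrite lt_max ltrDl ltr01 orbT.
Qed.

Lemma weak_inner_continuous (H : hilbertType R) (u : H) :
  continuous (fun x : weak H => inner (x : H) u).
Proof.
move=> x; pose ev (y : weak H) : {ptws H -> R} := fun v : H => inner (y : H) v.
apply: (@continuous_comp _ _ _ ev (fun phi : {ptws H -> R} => phi u)).
  exact: (@initial_continuous H {ptws H -> R} (fun y v => inner y v)).
exact: (@proj_continuous H (fun=> R) u).
Qed.

(** Uniform boundedness: the functionals <x, .> with [x] in [C] are pointwise bounded, since each
    <., u> maps [C] to a compact set of reals; testing at x / |x| recovers |x|. *)
Lemma weakly_compact_bounded (H : hilbertType R) (C : set H) :
  weakly_compact C -> exists M, forall x, C x -> `|x| <= M.
Proof.
move=> cC.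
have [||M hM] := @Banach_Steinhauss R H R^o [set inner x | x in C] _ _ 1.
- move=> _ [x Cx <-]; split; last first.
    by move=> a u v; rewrite innerDr innerZr.
  move=> r; exists (`|x| * r) => y yr.
  by apply: le_trans (norm_inner_le _ _) _; rewrite ler_wpM2l.
- move=> u.
  have : compact [set inner x u | x in C].
    apply: (@continuous_compact (weak H) R^o (fun x : weak H => inner (x : H) u)) => //.
    by apply: continuous_subspaceT; exact: weak_inner_continuous.
  move=> /compact_bounded[M [_ hM]].
  exists (M + 1) => _ [x Cx <-].
  by apply: (hM (M + 1)); [rewrite ltrDl|exists x].
exists M => x Cx.
have [->|x0] := eqVneq x 0.
  have := hM _ (ex_intro2 _ _ x Cx erefl) 0; rewrite normr0 => /(_ ler01).
  exact: le_trans.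
have nx : 0 < `|x| by rewrite normr_gt0.
have := hM _ (ex_intro2 _ _ x Cx erefl) (`|x|^-1 *: x).
rewrite normrZ normfV normr_id mulVf ?gt_eqF// innerZr inner_norm => /(_ (lexx _)).
by rewrite expr2 mulrA mulVf ?gt_eqF// mul1r normr_id.
Qed.

End hilbert_operators.

(** * Convexity of extended-real-valued functions *)

Section extended_real_convexity.
Context {R : realType} {H : hilbertType R}.
Implicit Types (f G : H -> \bar R) (C : set H).

Lemma edom_fineK f x : (forall x, -oo < f x)%E -> edom f x -> ((fine (f x))%:E = f x)%E.
Proof. by move=> fN fx; rewrite fineK// fin_numElt fN. Qed.

(** The ends t = 0 and t = 1, which [econvex] leaves out, are immediate; in between, finiteness at
    [x] and [s] carries over to the intermediate point, so the inequality descends to real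
    numbers. *)
Lemma econvex_fine f x s t : (forall x, -oo < f x)%E -> econvex f ->
  edom f x -> edom f s -> 0 <= t <= 1 ->
  edom f (x + t *: (s - x)) /\
  fine (f (x + t *: (s - x))) <= fine (f x) + t * (fine (f s) - fine (f x)).
Proof.
move=> fN cf fx fs /andP[]; rewrite le_eqVlt => /predU1P[<- _|t0].
  by rewrite scale0r addr0 mul0r addr0.
rewrite le_eqVlt => /predU1P[->|t1].
  by rewrite scale1r mul1r addrC subrK addrC subrK.
have -> : x + t *: (s - x) = t *: s + (1 - t) *: x.
  by rewrite scalerBr scalerBl scale1r addrA addrAC addrC addrA.
have := cf s x t; rewrite t0 t1 => /(_ isT).
rewrite -(edom_fineK fN fs) -(edom_fineK fN fx) -!EFinM -EFinD => h.
have d : edom f (t *: s + (1 - t) *: x) by apply: le_lt_trans h (ltry _).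
split=> //; move: h; rewrite -(edom_fineK fN d) lee_fin /=; lra.
Qed.

(** For t in ]0,1[ the hypothesis bounds the difference quotient by phi(x + v) - phi(x); the bound
    passes to the limit from the right. *)
Lemma diff_le_of_convex (phi : H -> R) x v :
  differentiable phi x ->
  (forall t, 0 < t < 1 -> phi (x + t *: v) <= phi x + t * (phi (x + v) - phi x)) ->
  'd phi x v <= phi (x + v) - phi x.
Proof.
move=> dphi h; rewrite -deriveE//.
have dv := @diff_derivable _ _ _ phi x v dphi.
rewrite /derive cvg_at_rightE//; apply: limr_le.
  apply: (cvgP ('D_v phi x)); apply: cvg_dnbhs_at_right; exact: dv.
near=> t.
have t0 : 0 < t by near: t; exact: nbhs_right_gt.
have t1 : t < 1 by near: t; exact: nbhs_right_lt.
rewrite /= [t *: v + x]addrC [X in X <= _]mulrC ler_pdivrMr// lerBlDl mulrC.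
by apply: h; rewrite t0 t1.
Unshelve. all: by end_near.
Qed.

Lemma gradient_le f x y : (forall x, -oo < f x)%E -> econvex f ->
  edom f x -> edom f y -> differentiable (fine \o f) x ->
  fine (f x) + inner (gradient f x) (y - x) <= fine (f y).
Proof.
move=> fN cf fx fy df; rewrite gradientP//.
have : 'd (fine \o f) x (y - x) <= (fine \o f) (x + (y - x)) - (fine \o f) x.
  apply: diff_le_of_convex => // t /andP[t0 t1] /=.
  rewrite [x + (y - x)]addrC subrK.
  by have [] := @econvex_fine f x y t fN cf fx fy; rewrite ?(ltW t0) ?(ltW t1).
by rewrite [x + (y - x)]addrC subrK /=; lra.
Qed.

End extended_real_convexity.

(** * Smoothness and proximal points *)

Section smoothness.
Context {R : realType} {H : hilbertType R}.

Lemma le_max0_fine (e : \bar R) : (e < +oo -> e <= (Num.max 0 (fine e))%:E)%E.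
Proof. by case: e => [r| |] //= _; rewrite ?leNye// lee_fin le_max lexx orbT. Qed.

(** Convexity of G - f bounds the linearisation error of [f] by the Bregman divergence of [G], which
    [smooth_const] bounds by a multiple of [zeta]: a descent lemma with zeta(t) in the place of
    t^2. *)
Lemma smooth_pair_descent (G f : H -> \bar R) (zeta : R -> R) (C : set H) :
  (forall t, 0 < t <= 1 -> 0 <= zeta t) ->
  (forall x s t, C x -> C s -> 0 <= t <= 1 -> C (x + t *: (s - x))) ->
  smooth_pair G zeta f C ->
  exists2 K, 0 <= K & forall x s t, C x -> C s -> 0 < t <= 1 ->
    fine (f (x + t *: (s - x))) <=
    fine (f x) + t * inner (gradient f x) (s - x) + K * zeta t.
Proof.
move=> zeta0 convC [_ [C0 [_ [CC0 _] dC0 convGf Kfin]]].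
exists (Num.max 0 (fine (smooth_const G zeta C))); first by rewrite le_max lexx.
set K := Num.max _ _ => x s t Cx Cs t01; have /andP[t0 t1] := t01.
set z := x + t *: (s - x).
have Cz : C z by apply: convC => //; rewrite (ltW t0) t1.
have zxE : z - x = t *: (s - x) by rewrite /z addrC addKr.
have [[/nbhs_singleton Gx dG] [_ df]] := dC0 _ (CC0 _ Cx).
have [[/nbhs_singleton Gz _] _] := dC0 _ (CC0 _ Cz).
have K0 : 0 <= K by rewrite le_max lexx.
set B := fine (G z) - fine (G x) - inner (gradient G x) (z - x).
have BK : B <= K * zeta t.
  have : (bregman G z x / (zeta t)%:E <= K%:E)%E.
    apply: le_trans (le_max0_fine Kfin); apply: ereal_sup_ubound.
    by exists x, s, t.
  rewrite /bregman -(fineK Gz) -(fineK Gx) -!EFinB -/B.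
  (* For zeta(t) = 0 the quotient is B times +oo, so a finite supremum leaves only B <= 0. *)
  have := zeta0 _ t01; rewrite le_eqVlt => /predU1P[<-|zt0]; last first.
    by rewrite inver gt_eqF// -EFinM lee_fin ler_pdivrMr.
  rewrite inve0 mulr0; case: (leP B 0) => // B0.
  by rewrite gt0_muley ?lte_fin.
have dGf := @differentiableB _ _ _ (fine \o G) (fine \o f) x dG df.
have : 'd ((fine \o G) \- (fine \o f)) x (z - x) <=
    ((fine \o G) \- (fine \o f)) (x + (z - x)) - ((fine \o G) \- (fine \o f)) x.
  apply: diff_le_of_convex => // u /andP[u0 u1].
  have convE (k : {i01 R}) (a b : convex_lmodType H) :
      conv k a b = ((b : H) + k%:num *: ((a : H) - b) : H).
    rewrite -[LHS]/(k%:num *: (a : H) + (1 - k%:num) *: (b : H)).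
    by rewrite scalerBl scale1r scalerBr addrA addrAC addrC addrA.
  (* [C] itself serves as the convex subset of [C0]; it contains the segment from [x] to [z]. *)
  have Cconv : @convex_set _ H C.
    move=> a b k; rewrite !inE convE => Ca Cb.
    by apply: convC => //; rewrite ge0 le1.
  pose phi y := fine (G y) - fine (f y).
  have h : phi (x + u *: (z - x)) <= u * phi z + (1 - u) * phi x.
    have := convGf C Cconv CC0 (Itv01 (ltW u0) (ltW u1)) z x.
    by rewrite !inE => /(_ Cz Cx); rewrite convE.
  rewrite [x + (z - x)]addrC subrK.
  change (phi (x + u *: (z - x)) <= phi x + u * (phi z - phi x)).
  apply: le_trans h _; move: (phi z) (phi x) => pz px.
  by rewrite mulrBr mulrBl mul1r addrCA.
rewrite [x + (z - x)]addrC subrK.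
rewrite (_ : 'd _ x (z - x) = 'd (fine \o G) x (z - x) - 'd (fine \o f) x (z - x)); last first.
  by have /(congr1 (fun k : H -> R => k (z - x))) := @diffB _ _ _ (fine \o G) (fine \o f) x dG df.
rewrite -(gradientP (z - x) dG) -(gradientP (z - x) df) => h.
have -> : t * inner (gradient f x) (s - x) = inner (gradient f x) (z - x).
  by rewrite zxE innerZr.
move: h BK; rewrite /B /=.
generalize (inner (gradient G x) (z - x)) (inner (gradient f x) (z - x))
  (fine (G z)) (fine (G x)) (fine (f z)) (fine (f x)) (K * zeta t).
by clear => *; lra.
Qed.

End smoothness.

(** * Proximal points and the Moreau envelope *)

Section prox.
Context {R : realType} {H : hilbertType R} (g : H -> \bar R).
Hypothesis g_proper : eproper g.
Implicit Types (p q u v y : H) (beta : R).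

(** At a point [v] of the domain, g(p) = +oo would force g(v) = +oo. *)
Lemma subdifferential_edom p u : subdifferential g p u -> edom g p.
Proof.
have [gN [v gv]] := g_proper.
move=> /(_ v); rewrite /edom /=; case: (g p) => [r| |] //=; first by rewrite ltry.
by rewrite addye// leye_eq => /eqP h; move: gv; rewrite /edom /= h ltxx.
Qed.

Lemma subdifferential_fineP p u : edom g p ->
  subdifferential g p u <->
  forall v, edom g v -> fine (g p) + inner u (v - p) <= fine (g v).
Proof.
have [gN _] := g_proper => gp; split=> h v.
  move=> gv; have := h v.
  by rewrite -(edom_fineK gN gv) -(edom_fineK gN gp) -EFinD lee_fin.
have [gv|] := pselect (edom g v).
  by rewrite -(edom_fineK gN gv) -(edom_fineK gN gp) -EFinD lee_fin h.
by rewrite /edom /= => /negP; rewrite -leNgt leye_eq => /eqP ->; rewrite leey.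
Qed.

(** The subdifferential is an intersection of sets cut out by one affine inequality each, hence
    closed and stable under midpoints; [ex_min_norm] then shows that [get] picks a genuine
    element. *)
Lemma min_normP p : dom_subdifferential g p ->
  subdifferential g p (min_norm (subdifferential g p)).
Proof.
move=> [w pw]; have gp := subdifferential_edom pw.
set S := subdifferential g p.
have SE : S = \bigcap_(v in edom g)
    ((fun u => inner u (v - p)) @^-1` [set r | r <= fine (g v) - fine (g p)]).
  apply/seteqP; split=> [u /(subdifferential_fineP _ gp) hu v gv|u hu].
    by rewrite /= lerBrDl hu.
  apply/(subdifferential_fineP _ gp) => v gv.
  by rewrite -lerBrDl; exact: hu.
have [|||u Su umin] := @ex_min_norm R H S; first by exists w.
- rewrite SE; apply: closed_bigI => v _; apply: closed_comp; last exact: closed_le.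
  by move=> *; exact: inner_continuous.
- move=> a b; rewrite SE => ha hb v gv /=.
  have := ha v gv; have := hb v gv; rewrite /= innerZl innerDl; lra.
have := @getPex _ [set u | S u /\ forall v, S v -> (`|u| <= `|v|)%R].
by move=> /(_ (ex_intro _ u (conj Su umin)))[].
Qed.

Variable beta : R.
Hypothesis beta_gt0 : 0 < beta.

Lemma prox_edom p y : prox (fun v => beta%:E * g v)%E p y -> edom g y.
Proof.
have [gN [v gv]] := g_proper.
move=> /(_ v) /=; rewrite /edom /= -(edom_fineK gN gv); case: (g y) => [r| |] //=.
  by rewrite ltry.
by rewrite gt0_muley ?lte_fin// addye// leye_eq -EFinM -EFinD.
Qed.

Lemma prox_le p y v : prox (fun v => beta%:E * g v)%E p y -> edom g v ->
  fine (g y) + (2 * beta)^-1 * `|p - y| ^+ 2 <=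
  fine (g v) + (2 * beta)^-1 * `|p - v| ^+ 2.
Proof.
have [gN _] := g_proper => py gv; have gy := prox_edom py.
have := py v; rewrite /= -(edom_fineK gN gv) -(edom_fineK gN gy).
rewrite -!EFinM -!EFinD lee_fin /= => h.
have E (r n : R) : beta * (r + (2 * beta)^-1 * n) = beta * r + 2^-1 * n.
  by field; rewrite gt_eqF.
by rewrite -(ler_pM2l beta_gt0) !E.
Qed.

Hypothesis g_convex : econvex g.

(** If a > 0, then t = 1/2 gives b > 0, and t = a / (2 b), which is below 1, gives a <= a / 2. *)
Lemma le0_of_le_small (a b : R) : (forall t, 0 < t < 1 -> a <= t * b) -> a <= 0.
Proof.
move=> h; rewrite leNgt; apply/negP => a0.
have h2 : a <= 2^-1 * b by apply: h; rewrite invr_gt0 ltr0n invf_lt1// ltr1n.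
have b0 : 0 < b by lra.
have /h : 0 < a / (2 * b) < 1.
  by rewrite divr_gt0 ?mulr_gt0//= ltr_pdivrMr ?mulr_gt0//; lra.
rewrite invfM mulrA mulrVK ?unitfE ?gt_eqF//; lra.
Qed.

(** Compare [y] with y + t (v - y), divide by [t] and let [t] vanish through [le0_of_le_small]: the
    optimality condition makes (p - y) / beta a subgradient at [y]. *)
Lemma prox_subgradient p y v :
  prox (fun v => beta%:E * g v)%E p y -> edom g v ->
  fine (g y) + beta^-1 * inner (p - y) (v - y) <= fine (g v).
Proof.
have [gN _] := g_proper => py gv; have gy := prox_edom py.
rewrite -subr_le0.
apply: (@le0_of_le_small _ ((2 * beta)^-1 * `|v - y| ^+ 2)) => t /andP[t0 t1].
have [gw gwle] := @econvex_fine _ _ g y v t gN g_convex gy gv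
  (introT andP (conj (ltW t0) (ltW t1))).
have := prox_le py gw.
rewrite opprD addrA [`|p - y - _| ^+ 2]sqr_normB innerZr sqr_normZ => h.
rewrite -(ler_pM2l t0).
have bE : beta^-1 = 2 * (2 * beta)^-1 by rewrite invfM mulrA mulfV ?mul1r.
rewrite bE; move: ((2 * beta)^-1) h => k h; lra.
Qed.

(** The right side is the Moreau envelope at [p]. The subgradient inequality at [p], tested at [y],
    and Young with weight beta show that smoothing lowers g(p) by at most (beta / 2) |q|^2. *)
Lemma moreau_ge p y q : prox (fun v => beta%:E * g v)%E p y ->
  subdifferential g p q ->
  fine (g p) - beta / 2 * `|q| ^+ 2 <=
  fine (g y) + (2 * beta)^-1 * `|p - y| ^+ 2.
Proof.
move=> py pq; have gp := subdifferential_edom pq; have gy := prox_edom py.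
have := (subdifferential_fineP _ gp).1 pq y gy.
have := inner_young q (p - y) beta_gt0.
rewrite -(opprB p y) innerNr; lra.
Qed.

(* The point p + (beta' / beta) (v - p) competes in the definition of the
   Moreau envelope with the smaller parameter beta'. *)
Lemma moreau_change (beta' : R) p v y' q : 0 < beta' <= beta ->
  (forall w, edom g w -> fine (g y') + (2 * beta')^-1 * `|p - y'| ^+ 2 <=
     fine (g w) + (2 * beta')^-1 * `|p - w| ^+ 2) ->
  edom g v -> subdifferential g p q ->
  fine (g y') + (2 * beta')^-1 * `|p - y'| ^+ 2 <=
  fine (g v) + (2 * beta)^-1 * `|p - v| ^+ 2 + (beta - beta') / 2 * `|q| ^+ 2.
Proof.
have [gN _] := g_proper => /andP[b'0 b'b] hy' gv pq.
have gp := subdifferential_edom pq.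
have [t tE] : exists t, t = beta' / beta by eexists.
have t0 : 0 <= t by rewrite tE divr_ge0 ?ltW.
have t1 : t <= 1 by rewrite tE ler_pdivrMr// mul1r.
have [gw gwle] := @econvex_fine _ _ g p v t gN g_convex gp gv (introT andP (conj t0 t1)).
apply: le_trans (hy' _ gw) _.
rewrite opprD addrA subrr sub0r normrN sqr_normZ.
have -> : (2 * beta')^-1 * (t ^+ 2 * `|v - p| ^+ 2) = t * ((2 * beta)^-1 * `|p - v| ^+ 2).
  by rewrite tE distrC; field; rewrite !gt_eqF.
(* By convexity the competitor has value at most g(v) + (1 - t) (g(p) - g(v)). Bounding this gap by
   the subgradient inequality and Young, the quadratic terms add up to the one with parameter
   beta. *)
have sub := (subdifferential_fineP _ gp).1 pq v gv.
rewrite -(opprB p v) innerNr in sub.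
have young := inner_young q (p - v) beta_gt0.
have -> : (beta - beta') / 2 * `|q| ^+ 2 = (1 - t) * (beta / 2 * `|q| ^+ 2).
  by rewrite tE; field; rewrite gt_eqF.
have t1' : 0 <= 1 - t by lra.
have : (1 - t) * (fine (g p) - fine (g v)) <=
    (1 - t) * ((2 * beta)^-1 * `|p - v| ^+ 2 + beta / 2 * `|q| ^+ 2).
  by rewrite ler_wpM2l//; lra.
lra.
Qed.

End prox.

(** * Real sequences *)

Section real_sequences.
Context {R : realType}.
Implicit Types (u v w gamma a : R^nat).

(** For nonnegative sequences this is summability; [series u n] adds the terms of index below
    [n]. *)
Definition bounded_sums u := exists B, forall n, series u n <= B.

Lemma series_ge0 u : (forall k, 0 <= u k) -> forall n, 0 <= series u n.
Proof. by move=> u0 n; rewrite /series /=; apply: sumr_ge0. Qed.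

Lemma series_nondecreasing u : (forall k, 0 <= u k) ->
  {homo series u : m n / (m <= n)%N >-> m <= n}.
Proof. by move=> u0; apply: nondecreasing_series => k _ _; exact: u0. Qed.

Lemma ell1_plus_bounded_sums u : ell1_plus u -> bounded_sums u.
Proof.
move=> [u0 cu]; exists (limn [normed series u]) => n.
apply: (@le_trans _ _ ([normed series u] n)).
  by rewrite /series /=; apply: ler_sum => i _; exact: ler_norm.
apply: nondecreasing_cvgn_le => //.
by apply: series_nondecreasing => k /=.
Qed.

Lemma not_ell1_unbounded u : (forall k, 0 <= u k) -> ~ ell1 u ->
  forall B, exists n, B < series u n.
Proof.
move=> u0 nu B; apply: contrapT => /forallNP h; apply: nu.
apply: nondecreasing_is_cvgn.
  by apply: series_nondecreasing => k /=.
exists B => _ [n _ <-]; have /negP := h n; rewrite -leNgt; apply: le_trans.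
by rewrite /series /=; apply: ler_sum => i _; rewrite ger0_norm.
Qed.

Lemma bounded_sumsD u v :
  bounded_sums u -> bounded_sums v -> bounded_sums (fun k => u k + v k).
Proof.
move=> [B hB] [B' hB']; exists (B + B') => n.
by rewrite /series /= big_split /= lerD// ?hB// hB'.
Qed.

Lemma bounded_sumsZ c u : 0 <= c -> bounded_sums u -> bounded_sums (fun k => c * u k).
Proof.
move=> c0 [B hB]; exists (c * B) => n.
by rewrite /series /= -mulr_sumr ler_wpM2l// hB.
Qed.

Lemma le_bounded_sums u v : (forall k, u k <= v k) -> bounded_sums v -> bounded_sums u.
Proof.
move=> uv [B hB]; exists B => n; apply: le_trans (hB n).
by rewrite /series /=; apply: ler_sum.
Qed.

Lemma bounded_sums_ge0 u : bounded_sums u -> exists2 B, 0 <= B & forall n, series u n <= B.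
Proof.
move=> [B hB]; exists B => //.
by have := hB 0%N; rewrite /series /= big_geq.
Qed.

(** A discrete Gronwall argument: 1 + w <= exp(w) bounds [u] by a constant [U], after which the
    errors w_k U have bounded sums and telescoping bounds the sums of [v]. *)
Lemma bounded_sums_quasi_fejer u v w :
  (forall k, 0 <= u k) -> (forall k, 0 <= w k) ->
  (forall k, 0 <= v k) -> bounded_sums w ->
  (forall k, u k.+1 + v k <= (1 + w k) * u k) -> bounded_sums v.
Proof.
move=> u0 w0 v0 /bounded_sums_ge0[B B0 hB] step.
have uexp n : u n <= u 0%N * expR (series w n).
  elim: n => [|n IH]; first by rewrite /series /= big_geq// expR0 mulr1.
  rewrite seriesSr expRD mulrA [leRHS]mulrC.
  apply: (@le_trans _ _ ((1 + w n) * u n)).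
    by have := step n; have := v0 n; lra.
  by apply: ler_pM; rewrite ?addr_ge0 ?expR_ge1Dx.
pose U := u 0%N * expR B.
have uU n : u n <= U by apply: le_trans (uexp n) _; rewrite ler_wpM2l// ler_expR.
have U0 : 0 <= U by apply: le_trans (uU 0%N).
exists (u 0%N + U * B) => n.
have : series v n + u n <= u 0%N + U * series w n.
  elim: n => [|n IH]; first by rewrite /series /= !big_geq// mulr0 add0r addr0.
  rewrite !seriesSr; have := step n.
  have : w n * u n <= w n * U by rewrite ler_wpM2l.
  lra.
have : U * series w n <= U * B by rewrite ler_wpM2l.
have := u0 n; lra.
Qed.

(* The cubes have summable increments:
   |a_{k+1}^3 - a_k^3| <= 3/2 |a_{k+1} - a_k| (a_{k+1}^2 + a_k^2). *)
Lemma cvg0_of_bounded_sums_sqr gamma a L :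
  (forall k, 0 <= gamma k <= 1) -> (forall k, 0 <= a k) ->
  (forall B, exists n, B < series gamma n) ->
  (forall k, `|a k.+1 - a k| <= L * gamma k) ->
  bounded_sums (fun k => gamma k ^+ 2) ->
  bounded_sums (fun k => gamma k * a k ^+ 2) ->
  a @ \oo --> (0 : R).
Proof.
move=> g01 a0 gunb aL bg bga.
have g0 k : 0 <= gamma k by case/andP: (g01 k).
have L0 : 0 <= L.
  have [n] := gunb 0; rewrite ltNge => /negP; apply: contra_notP => /negP.
  rewrite -ltNge => L0; rewrite /series /= big1// => i _.
  apply/le_anti; rewrite g0 andbT leNgt; apply/negP => gi.
  have := le_trans (normr_ge0 _) (aL i); rewrite leNgt => /negP; apply.
  by rewrite nmulr_rlt0.
(* This majorises the increments of the cubes: a_{k+1}^2 <= 2 a_k^2 + 2 (a_{k+1} - a_k)^2, and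
   gamma^3 <= gamma^2 because gamma <= 1. *)
pose W k := 3 / 2 * L * (3 * (gamma k * a k ^+ 2) + 2 * L ^+ 2 * gamma k ^+ 2).
have W0 k : 0 <= W k.
  by rewrite !mulr_ge0// addr_ge0// !mulr_ge0// sqr_ge0.
have bW : bounded_sums W.
  apply: bounded_sumsZ; first by rewrite !mulr_ge0.
  apply: bounded_sumsD; apply: bounded_sumsZ => //.
  by rewrite mulr_ge0 ?sqr_ge0.
have stepW k : a k.+1 ^+ 3 - a k ^+ 3 <= W k.
  have -> : a k.+1 ^+ 3 - a k ^+ 3 =
     (a k.+1 - a k) * (a k.+1 ^+ 2 + a k.+1 * a k + a k ^+ 2) by ring.
  have h1 : a k.+1 - a k <= L * gamma k by apply: le_trans (ler_norm _) (aL k).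
  have h2 : (a k.+1 - a k) ^+ 2 <= (L * gamma k) ^+ 2.
    by rewrite -(real_normK (num_real _)) ler_sqr ?nnegrE ?mulr_ge0// aL.
  have q0 : 0 <= a k.+1 ^+ 2 + a k.+1 * a k + a k ^+ 2.
    by rewrite !addr_ge0 ?sqr_ge0 ?mulr_ge0.
  have h3 : a k.+1 ^+ 2 + a k.+1 * a k + a k ^+ 2 <=
      3 / 2 * (3 * a k ^+ 2 + 2 * (L * gamma k) ^+ 2).
    have := sqr_ge0 (a k.+1 - a k); have := sqr_ge0 (a k.+1 - 2 * a k); lra.
  apply: le_trans (ler_wpM2r q0 h1) _.
  apply: le_trans (ler_wpM2l (mulr_ge0 L0 (g0 k)) h3) _.
  have h4 : gamma k * gamma k ^+ 2 <= 1 * gamma k ^+ 2.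
    by rewrite ler_wpM2r ?sqr_ge0//; case/andP: (g01 k).
  have : 0 <= 3 * L ^+ 3 by rewrite mulr_ge0// exprn_ge0.
  move=> /ler_wpM2l/(_ _ _ h4); rewrite /W; lra.
have [BW hBW] := bW.
have cW : cvgn (series W).
  apply: nondecreasing_is_cvgn; first exact: series_nondecreasing.
  by exists BW => _ [n _ <-].
(* Subtracting the partial sums of [W] makes the cubes non-increasing while they stay bounded
   below. *)
have cp : cvgn (fun k => a k ^+ 3).
  have -> : (fun k => a k ^+ 3) = (fun k => a k ^+ 3 - series W k) \+ series W.
    by apply/funext => k /=; rewrite subrK.
  apply: is_cvgD => //; apply: nonincreasing_is_cvgn.
    apply/nonincreasing_seqP => n.
    rewrite seriesSr; have := stepW n; lra.
  exists (- BW) => _ [n _ <-]; rewrite lerBrDl.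
  by apply: le_trans (exprn_ge0 3 (a0 n)); rewrite subr_le0.
set l := limn _ in cp.
have l0 : 0 <= l.
  by apply: limr_ge => //; apply: nearW => k; rewrite exprn_ge0.
have lE : l = 0.
  apply/eqP; apply: contraT => lN0; exfalso.
  have lpos : 0 < l by rewrite lt_neqAle eq_sym lN0.
  (* Since m <= 1, m^3 <= m <= l / 2, so a_k^3 > l / 2 forces a_k >= m from some rank on; the
     divergence of the sums of gamma then contradicts [bga]. *)
  pose m := Num.min 1 (l / 2).
  have m0 : 0 < m by rewrite lt_min ltr01 divr_gt0.
  have m1 : m <= 1 by rewrite ge_min lexx.
  have ml : m <= l / 2 by rewrite ge_min lexx orbT.
  have [N _ hN] : \forall k \near \oo, m ^+ 2 <= a k ^+ 2.
    have : l / 2 < l by lra.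
    move=> /(cvgr_gt _ cp); apply: filterS => k hk.
    rewrite ler_sqr ?nnegrE ?(ltW m0)// leNgt; apply/negP => akm.
    have : a k ^+ 3 <= m.
      apply: le_trans (_ : m ^+ 3 <= m).
        by apply: lerXn2r; rewrite ?nnegrE ?(ltW m0) ?(ltW akm).
      by rewrite -[leRHS]expr1 ler_wiXn2l// ltW.
    lra.
  have [B hB] := bga.
  have [n hn] := gunb (series gamma N + (m ^+ 2)^-1 * B).
  have B0 : 0 <= B by have := hB 0%N; rewrite /series /= big_geq.
  have Nn : (N <= n)%N.
    rewrite leqNgt; apply/negP => /ltnW/(series_nondecreasing g0).
    have : 0 <= (m ^+ 2)^-1 * B by rewrite mulr_ge0// invr_ge0 sqr_ge0.
    lra.
  have mm : 0 < m ^+ 2 by rewrite exprn_gt0.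
  have : m ^+ 2 * (series gamma n - series gamma N) <= B.
    rewrite sub_series_geq// mulr_sumr; apply: le_trans (hB n).
    rewrite -[leRHS](subrK (series (fun k => gamma k * a k ^+ 2) N)).
    rewrite sub_series_geq// -[leLHS]addr0; apply: lerD.
      apply: ler_sum_nat => i /andP[Ni _]; rewrite mulrC ler_wpM2l//; exact: hN.
    by apply: series_ge0 => k; rewrite mulr_ge0 ?sqr_ge0.
  rewrite -ler_pdivlMl//; lra.
apply/cvgrPdist_lt => e e0.
have : l < e ^+ 3 by rewrite lE exprn_gt0.
move=> /(cvgr_lt _ cp); apply: filterS => k hk.
rewrite sub0r normrN ger0_norm// ltNge; apply/negP => eak.
have : e ^+ 3 <= a k ^+ 3 by apply: lerXn2r; rewrite ?nnegrE ?(ltW e0).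
lra.
Qed.

(* Abel-Dini: otherwise gamma_k / Gamma_k would be summable. *)
Lemma frequently_le_sqrt_psum gamma a :
  (forall k, 0 < gamma k) -> (forall k, 0 <= a k) ->
  (forall B, exists n, B < series gamma n) ->
  bounded_sums (fun k => gamma k * a k ^+ 2) ->
  forall N, exists2 k, (N <= k)%N & a k <= (Num.sqrt (psum gamma k))^-1.
Proof.
move=> g0 a0 gunb bga N; apply: contrapT => hN.
have {}hN k : (N <= k)%N -> (series gamma k.+1)^-1 <= a k ^+ 2.
  move=> Nk; have s0 : 0 < series gamma k.+1.
    by rewrite seriesSr ltr_wpDl// series_ge0// => i; exact: ltW.
  have lt : (Num.sqrt (series gamma k.+1))^-1 < a k.
    by rewrite ltNge; apply/negP => h; apply: hN; exists k.
  have -> : (series gamma k.+1)^-1 = (Num.sqrt (series gamma k.+1))^-1 ^+ 2.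
    by rewrite exprVn sqr_sqrtr// ltW.
  by rewrite ler_sqr ?nnegrE ?invr_ge0 ?sqrtr_ge0// ltW.
set S := series (fun k => gamma k * a k ^+ 2) in bga.
have S_nd : {homo S : m n / (m <= n)%N >-> m <= n}.
  by apply: series_nondecreasing => k; rewrite mulr_ge0 ?sqr_ge0// ltW.
have hS : has_sup (range S).
  by split; [exists (S 0%N), 0%N|have [B hB] := bga; exists B => _ [n _ <-]].
have h20 : 0 < 2^-1 :> R by rewrite invr_gt0.
have [_ [M0 _ <-] hM0] := sup_adherent h20 hS.
pose M := maxn M0 N.
have SM n : S n - S M <= 2^-1.
  have : S n <= sup (range S) by apply: sup_ubound; [case: hS|exists n].
  have : S M0 <= S M by apply: S_nd; exact: leq_maxl.
  lra.
have g0' k : 0 <= gamma k by exact: ltW.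
(* Once the partial sum at [n] exceeds twice that at [M], the terms between carry more than half of
   it; yet each a_k^2 there is at least the inverse of [series gamma n], so [SM] limits this share
   to 1/2. *)
have [n hn] := gunb (2 * series gamma M).
have sM0 := series_ge0 g0' M.
have Mn : (M <= n)%N.
  rewrite leqNgt; apply/negP => /ltnW/(series_nondecreasing g0'); lra.
have sn : 0 < series gamma n by lra.
have : (series gamma n - series gamma M) / series gamma n <= 2^-1.
  apply: le_trans (SM n); rewrite /S !sub_series_geq// mulr_suml.
  apply: ler_sum_nat => k /andP[Mk kn]; rewrite ler_wpM2l//.
  apply: le_trans (hN _ (leq_trans (leq_maxr _ _) Mk)).
  rewrite lef_pV2 ?posrE//; first exact: series_nondecreasing.
  by rewrite seriesSr ltr_wpDl// series_ge0.
rewrite ler_pdivrMr//; lra.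
Qed.

(** Each next index is chosen from rank phi(i) + 1 on, which makes the increase strict. *)
Lemma increasing_subsequence (P : nat -> Prop) :
  (forall N, exists2 k, (N <= k)%N & P k) ->
  exists phi : nat -> nat, {homo phi : i j / (i < j)%N} /\ forall j, P (phi j).
Proof.
move=> hP; have [next hnext] := choice (fun N => let: ex_intro2 k Nk Pk := hP N in
  ex_intro (fun k => (N <= k)%N /\ P k) k (conj Nk Pk)).
exists (fix phi j := if j is i.+1 then next (phi i).+1 else next 0%N); split.
  apply: homo_ltn => [|i]; first exact: ltn_trans.
  by have [] := hnext ((fix phi j := if j is i.+1 then next (phi i).+1 else next 0%N) i).+1.
by case=> [|j]; [have [] := hnext 0%N|have [] := hnext
  ((fix phi j := if j is i.+1 then next (phi i).+1 else next 0%N) j).+1].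
Qed.

End real_sequences.

(** * Weighted means and step-size ratios *)

Section weighted_means.
Context {R : realType}.

(** A Cauchy-Schwarz estimate done termwise: gamma a <= (r / 2) gamma a^2 + gamma / (2 r), where r
    is the square root of [psum gamma k], so that both sums are of order r. *)
Lemma series_le_sqrt_psum (gamma a : R^nat) B k :
  (forall i, 0 < gamma i) -> series (fun i => gamma i * a i ^+ 2) k.+1 <= B ->
  \sum_(0 <= i < k.+1) gamma i * a i <= (B + 1) / 2 * Num.sqrt (psum gamma k).
Proof.
move=> g0 hB; set G := psum gamma k.
have G0 : 0 < G.
  by rewrite /G /psum big_nat_recr//= ltr_wpDl// sumr_ge0// => i _; exact: ltW.
have [r rE] : exists r, r = Num.sqrt G by eexists.
have r0 : 0 < r by rewrite rE sqrtr_gt0.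
have GE : G = r ^+ 2 by rewrite rE sqr_sqrtr// ltW.
rewrite -rE; apply: (@le_trans _ _
  (r / 2 * series (fun i => gamma i * a i ^+ 2) k.+1 + (2 * r)^-1 * G)).
  rewrite /series /= /G /psum !mulr_sumr -big_split /=; apply: ler_sum => i _.
  rewrite -subr_ge0.
  have -> : r / 2 * (gamma i * a i ^+ 2) + (2 * r)^-1 * gamma i - gamma i * a i =
     gamma i * ((2 * r)^-1 * (r * a i - 1) ^+ 2) by field; rewrite gt_eqF.
  apply: mulr_ge0; first exact: ltW.
  by apply: mulr_ge0; [rewrite invr_ge0 mulr_ge0// ltW|exact: sqr_ge0].
have h : r / 2 * series (fun i => gamma i * a i ^+ 2) k.+1 <= r / 2 * B.
  by rewrite ler_wpM2l// divr_ge0// ltW.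
apply: le_trans (lerD h (lexx _)) _.
by rewrite GE le_eqVlt; apply/orP; left; apply/eqP; field; rewrite gt_eqF.
Qed.

(** The normalised weights add up to 1, so [b] moves inside the mean. *)
Lemma ergodicB (H K : hilbertType R) (A : {linear H -> K}) (b : K) gamma x k :
  psum gamma k != 0 ->
  A (ergodic gamma x k) - b =
  (psum gamma k)^-1 *: \sum_(0 <= i < k.+1) gamma i *: (A (x i) - b).
Proof.
move=> G0; rewrite /ergodic linearZ linear_sum.
under [in RHS]eq_bigr do rewrite scalerBr.
rewrite sumrB scalerBr -scaler_suml scalerA mulVf// scale1r.
by under eq_bigr do rewrite linearZ.
Qed.

(** If m < 1, the sequence never falls below its first term, and its squares cannot have bounded
    sums. Applied to [Mhi], this turns [c_large] into a bound on 1 / c. *)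
Lemma one_le_ratio (gamma : R^nat) (m : R) :
  (forall k, 0 < gamma k) -> bounded_sums (fun k => gamma k ^+ 2) ->
  (forall k, gamma k <= m * gamma k.+1) -> 1 <= m.
Proof.
move=> g0 [B hB] hm; rewrite leNgt; apply/negP => m1.
have ge0 k : gamma 0%N <= gamma k.
  elim: k => [//|k]; move/le_trans; apply; apply: le_trans (hm k) _.
  by rewrite ler_piMl// ltW.
have q0 : 0 < gamma 0%N ^+ 2 by rewrite exprn_gt0.
have h n : n%:R <= B / gamma 0%N ^+ 2.
  rewrite ler_pdivlMr//; apply: le_trans (hB n).
  rewrite /series /= -[n in n%:R]subn0 -sumr_const_nat mulr_suml.
  by apply: ler_sum => i _; rewrite mul1r ler_sqr ?nnegrE ?(ltW (g0 _)).
have [n] : exists n, B / gamma 0%N ^+ 2 < n%:R.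
  by exists (Num.truncn (B / gamma 0%N ^+ 2)).+1; rewrite truncnS_gt.
by rewrite ltNge h.
Qed.

End weighted_means.

(** * The Lyapunov function *)

Section lyapunov.
Context {R : realType} {H : hilbertType R}.
Variables (c M B DA rhomax Phi : R).
Hypotheses (c_gt0 : 0 < c) (rhomax_ge0 : 0 <= rhomax).
Implicit Types (e ad nu mus : H).

(* [S] stands for f(x) + g^beta(Tx) + h(x) and [nu] for mu - mu*. *)
Definition lyapunov (S beta rho : R) e nu mus : R :=
  S - Phi + inner (nu + mus) e + rho / 2 * `|e| ^+ 2 + c / 2 * `|nu| ^+ 2
  + beta / 2 * M ^+ 2 + (rhomax - rho) / 2 * B ^+ 2 + (B ^+ 2 / c + 1).

(** Young with weight c / 2 absorbs <nu, e> into half of (c / 2) |nu|^2 and the constant B^2 / c;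
    the extra 1 keeps the function at least 1, so that additive errors become multiplicative
    ones. *)
Lemma lyapunov_ge S beta rho e nu mus : 0 <= rho <= rhomax -> `|e| <= B ->
  Phi <= S + beta / 2 * M ^+ 2 + inner mus e ->
  c / 4 * `|nu| ^+ 2 + 1 <= lyapunov S beta rho e nu mus.
Proof.
move=> /andP[rho0 rhom] eB hPhi; rewrite /lyapunov innerDl.
have eB2 : `|e| ^+ 2 <= B ^+ 2 by rewrite lerXn2r ?nnegrE ?(le_trans _ eB).
have c2 : 0 < c / 2 by rewrite divr_gt0.
have := inner_young nu (- e) c2.
rewrite innerNr normrN (_ : 2 * (c / 2) = c); last by field.
have : c^-1 * `|e| ^+ 2 <= B ^+ 2 / c by rewrite mulrC ler_pM2r ?invr_gt0.
have : 0 <= rho / 2 * `|e| ^+ 2 by rewrite mulr_ge0 ?sqr_ge0 ?divr_ge0.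
have : 0 <= (rhomax - rho) / 2 * B ^+ 2.
  by rewrite mulr_ge0 ?sqr_ge0// divr_ge0// subr_ge0.
lra.
Qed.

(** Up to an error in gam beta, the bounds on [D] and [Phi] leave - gam <nu, e> - gam rho |e|^2 at
    first order, and the increment of (c / 2) |nu|^2 cancels the inner product. The dual step adds
    (gam / c) |e'|^2, whence the factor rho - 1 / c. *)
Lemma lyapunov_step S S' beta beta' rho rho' gam D r e ad nu mus :
  0 <= beta -> 0 <= rho <= rhomax -> rho <= rho' -> 0 < gam <= 1 ->
  `|e| <= B -> `|e + gam *: ad| <= B -> `|ad| <= DA -> 0 <= r ->
  S' <= S + gam * D + r + (beta - beta') / 2 * M ^+ 2 ->
  D + inner (nu + mus) ad + rho * inner e ad <=
    Phi - S - inner (nu + mus) e - rho * `|e| ^+ 2 ->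
  Phi <= S + beta / 2 * M ^+ 2 + inner mus e ->
  lyapunov S' beta' rho' (e + gam *: ad) (nu + (gam / c) *: (e + gam *: ad)) mus
    + (rho - c^-1) * (gam * `|e| ^+ 2) <=
  (1 + (r + gam * beta * (M ^+ 2 / 2) + gam ^+ 2 *
     (2 / c + (rhomax * DA ^+ 2 / 2 + (B ^+ 2 + 2 * DA ^+ 2) / c + DA ^+ 2 / 2
        + B ^+ 2 / (2 * c)))))
  * lyapunov S beta rho e nu mus.
Proof.
move=> beta0 rho01 rhole /andP[g0 g1] eB e'B adD r0 hS hD hPhi.
have [rho0 rhom] := andP rho01.
have U1 := @lyapunov_ge S beta rho e nu mus rho01 eB hPhi.
set U := lyapunov S beta rho e nu mus in U1 *.
set e' := e + gam *: ad in e'B *.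
have eB2 : `|e| ^+ 2 <= B ^+ 2 by rewrite lerXn2r ?nnegrE ?(le_trans _ eB).
have e'B2 : `|e'| ^+ 2 <= B ^+ 2 by rewrite lerXn2r ?nnegrE ?(le_trans _ e'B).
have ad2 : `|ad| ^+ 2 <= DA ^+ 2 by rewrite lerXn2r ?nnegrE ?(le_trans _ adD).
have e'E : `|e'| ^+ 2 = `|e| ^+ 2 + 2 * gam * inner e ad + gam ^+ 2 * `|ad| ^+ 2.
  by rewrite sqr_normD innerZr sqr_normZ mulrA.
have nu'E : c / 2 * `|nu + (gam / c) *: e'| ^+ 2 =
    c / 2 * `|nu| ^+ 2 + gam * inner nu e + gam ^+ 2 * inner nu ad
    + gam ^+ 2 * (`|e'| ^+ 2 / (2 * c)).
  rewrite sqr_normD sqr_normZ innerZr {1}/e' innerDr innerZr.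
  by field; rewrite gt_eqF.
have innE : inner (nu + (gam / c) *: e' + mus) e' =
    inner (nu + mus) e + gam * inner (nu + mus) ad + gam / c * `|e'| ^+ 2.
  rewrite [nu + _ + mus]addrAC [inner (nu + mus + _) _]innerDl innerZl inner_norm; congr (_ + _).
  by rewrite /e' innerDr innerZr.
have young1 : inner e ad <= (B ^+ 2 + DA ^+ 2) / 2.
  have := inner_young e ad (ltr01 : 0 < 1 :> R); rewrite mulr1; lra.
(* No bound on [nu] is at hand, so [lyapunov_ge] trades |nu|^2 / 2 for (2 / c) U; the error is
   therefore relative to [U]. *)
have young2 : inner nu ad <= 2 / c * U + DA ^+ 2 / 2.
  have := inner_young nu ad (ltr01 : 0 < 1 :> R); rewrite mulr1.
  have : 2 / c * (c / 4 * `|nu| ^+ 2 + 1) <= 2 / c * U.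
    by rewrite ler_wpM2l// divr_ge0// ltW.
  have -> : 2 / c * (c / 4 * `|nu| ^+ 2 + 1) = `|nu| ^+ 2 / 2 + 2 / c.
    by field; rewrite gt_eqF.
  have : 0 < 2 / c by rewrite divr_gt0.
  lra.
have nu0 : 0 <= c / 4 * `|nu| ^+ 2 by rewrite mulr_ge0 ?sqr_ge0 ?divr_ge0// ltW.
have ci : 0 < c^-1 by rewrite invr_gt0.
have gg : 0 <= gam ^+ 2 by exact: sqr_ge0.
have t1 := ler_wpM2l (ltW g0) hD.
have t2 := ler_wpM2l (ltW g0) hPhi.
have t3 : gam / c * `|e'| ^+ 2 <= c^-1 * (gam * `|e| ^+ 2)
    + gam ^+ 2 * ((B ^+ 2 + 2 * DA ^+ 2) / c).
  have -> : gam / c * `|e'| ^+ 2 = c^-1 * (gam * `|e| ^+ 2)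
     + c^-1 * (gam ^+ 2 * (2 * inner e ad + gam * `|ad| ^+ 2)).
    by rewrite e'E; ring.
  rewrite lerD2l mulrCA ler_wpM2l// mulrC ler_wpM2r ?(ltW ci)//.
  have : gam * `|ad| ^+ 2 <= 1 * `|ad| ^+ 2 by rewrite ler_wpM2r ?sqr_ge0.
  lra.
have t4 := ler_wpM2l gg young2.
have t5 : gam ^+ 2 * (`|e'| ^+ 2 / (2 * c)) <= gam ^+ 2 * (B ^+ 2 / (2 * c)).
  by rewrite ler_wpM2l// ler_wpM2r// invr_ge0 mulr_ge0// ltW.
have t6 : gam ^+ 2 * (rho * `|ad| ^+ 2 / 2) <= gam ^+ 2 * (rhomax * DA ^+ 2 / 2).
  by rewrite ler_wpM2l// ler_wpM2r// ler_pM ?sqr_ge0.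
(* The growth of [rho] is paid for by the decrease of the correction (rhomax - rho) B^2 / 2. *)
have t7 : (rho' - rho) / 2 * `|e'| ^+ 2 <= (rho' - rho) / 2 * B ^+ 2.
  by rewrite ler_wpM2l// divr_ge0// subr_ge0.
set C1 := rhomax * DA ^+ 2 / 2 + (B ^+ 2 + 2 * DA ^+ 2) / c + DA ^+ 2 / 2
        + B ^+ 2 / (2 * c).
have C10 : 0 <= C1.
  have B2 : 0 <= B ^+ 2 by exact: sqr_ge0.
  have D2 : 0 <= DA ^+ 2 by exact: sqr_ge0.
  have c0 : 0 <= c by exact: ltW.
  apply: addr_ge0; last by rewrite divr_ge0// mulr_ge0.
  apply: addr_ge0; last by rewrite divr_ge0.
  apply: addr_ge0; last by rewrite divr_ge0// addr_ge0// mulr_ge0.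
  by rewrite divr_ge0// mulr_ge0.
have U1' : 1 <= U by lra.
have u1 : r * 1 <= r * U by rewrite ler_wpM2l.
have u2 : gam * beta * (M ^+ 2 / 2) * 1 <= gam * beta * (M ^+ 2 / 2) * U.
  rewrite ler_wpM2l//; apply: mulr_ge0; last by rewrite divr_ge0 ?sqr_ge0.
  by rewrite mulr_ge0// ltW.
have u3 : gam ^+ 2 * C1 * 1 <= gam ^+ 2 * C1 * U by rewrite ler_wpM2l// mulr_ge0.
have C1E : gam ^+ 2 * C1 = gam ^+ 2 * (rhomax * DA ^+ 2 / 2)
    + gam ^+ 2 * ((B ^+ 2 + 2 * DA ^+ 2) / c) + gam ^+ 2 * (DA ^+ 2 / 2)
    + gam ^+ 2 * (B ^+ 2 / (2 * c)) by rewrite /C1; ring.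
have e'r : rho / 2 * `|e'| ^+ 2 = rho / 2 * `|e| ^+ 2 + gam * (rho * inner e ad)
    + gam ^+ 2 * (rho * `|ad| ^+ 2 / 2) by rewrite e'E; field.
have UE : U = S - Phi + inner (nu + mus) e + rho / 2 * `|e| ^+ 2
  + c / 2 * `|nu| ^+ 2 + beta / 2 * M ^+ 2 + (rhomax - rho) / 2 * B ^+ 2
  + (B ^+ 2 / c + 1) by [].
rewrite {1}/lyapunov nu'E innE.
rewrite (_ : inner (nu + mus) e = inner nu e + inner mus e) ?innerDl// in UE t1 *.
move: hS t1 t2 t3 t4 t5 t6 t7 u1 u2 u3 C1E e'r UE.
generalize (inner (nu + mus) ad) (inner nu e) (inner mus e) (inner e ad) (inner nu ad)
  (`|e'| ^+ 2) (`|e| ^+ 2) (`|nu| ^+ 2) (`|ad| ^+ 2) (B ^+ 2) (DA ^+ 2) (M ^+ 2)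
  (gam ^+ 2) (c^-1) ((2 * c)^-1) U C1.
clear -S S' Phi D r rho rho' beta beta' gam c rhomax => *; lra.
Qed.

End lyapunov.

(** * Saddle points of the Lagrangian *)

Section saddle_points.
Context {R : realType} {Hp Hd Hv : hilbertType R}.

(** The point [x0] makes the saddle value finite, hence each of its summands. The multiplier mus +
    (A xs - b) then turns the left saddle inequality into |A xs - b|^2 <= 0. *)
Lemma saddle_pointP (f h : Hp -> \bar R) (g : Hv -> \bar R)
    (A : Hp -> Hd) (T : Hp -> Hv) (b : Hd) (x0 xs : Hp) (mus : Hd) :
  (forall x, -oo < f x)%E -> (forall x, -oo < h x)%E -> (forall v, -oo < g v)%E ->
  edom f x0 -> edom h x0 -> edom g (T x0) -> saddle_point f h g A T b xs mus ->
  [/\ edom f xs, edom h xs, edom g (T xs), A xs = b &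
    forall x, edom f x -> edom h x -> edom g (T x) ->
      fine (f xs) + fine (g (T xs)) + fine (h xs) <=
      fine (f x) + fine (g (T x)) + fine (h x) + inner mus (A x - b)].
Proof.
move=> fN hN gN fx0 hx0 gx0 sp.
have LE x mu : edom f x -> edom h x -> edom g (T x) ->
    Lagrangian f h g A T b x mu =
    (fine (f x) + fine (g (T x)) + fine (h x) + inner mu (A x - b))%:E.
  move=> fx hx gx; rewrite /Lagrangian.
  by rewrite -(edom_fineK fN fx) -(edom_fineK hN hx) -(edom_fineK gN gx) -!EFinD.
have Lfin : (Lagrangian f h g A T b xs mus < +oo)%E.
  by apply: le_lt_trans (sp x0 mus).2 _; rewrite LE// ltry.
have [fxs hxs gxs] : [/\ edom f xs, edom h xs & edom g (T xs)].
  move: Lfin (fN xs) (hN xs) (gN (T xs)); rewrite /Lagrangian /edom /=.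
  by case: (f xs) => [?| |]; case: (g (T xs)) => [?| |]; case: (h xs) => [?| |].
have Axs : A xs = b.
  have := (sp xs (mus + (A xs - b))).1; rewrite !LE// lee_fin lerD2l innerDl.
  rewrite gerDl inner_norm => h1; apply/eqP; rewrite -subr_eq0 -normr_eq0 -sqrf_eq0.
  by apply/eqP/le_anti; rewrite h1 sqr_ge0.
split=> // x fx hx gx.
by have := (sp x mus).2; rewrite !LE// lee_fin Axs subrr -(scale0r 0) innerZr mul0r addr0.
Qed.

End saddle_points.

(** * One step of the algorithm *)

Section feasibility.
Context {R : realType} {Hp Hd Hv : hilbertType R}.
Variables (A : {linear Hp -> Hd}) (T : {linear Hp -> Hv}) (b : Hd).
Variables (f h : Hp -> \bar R) (g : Hv -> \bar R).
Variables (gamma beta theta rho : R^nat).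
Variables (x : nat -> Hp) (mu : nat -> Hd) (y : nat -> Hv) (z s : nat -> Hp).
Hypothesis A_bounded : bounded_near A (nbhs (0 : Hp)).
Hypothesis T_bounded : bounded_near T (nbhs (0 : Hp)).
Hypothesis f_Gamma0 : Gamma0 f.
Hypothesis g_Gamma0 : Gamma0 g.
Hypothesis h_Gamma0 : Gamma0 h.
Hypothesis T_dom : T @` edom h `<=` dom_subdifferential g.
Hypothesis gamma_in01 : forall k, 0 < gamma k <= 1.
Hypothesis beta_gt0 : forall k, 0 < beta k.
Hypothesis iterates : algorithm f h g A T b gamma beta theta rho x mu y z s.

Let fN : (forall x, -oo < f x)%E. Proof. by case: f_Gamma0 => -[]. Qed.
Let gN : (forall x, -oo < g x)%E. Proof. by case: g_Gamma0 => -[]. Qed.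
Let hN : (forall x, -oo < h x)%E. Proof. by case: h_Gamma0 => -[]. Qed.
Let f_convex : econvex f. Proof. by case: f_Gamma0. Qed.
Let g_convex : econvex g. Proof. by case: g_Gamma0. Qed.
Let h_convex : econvex h. Proof. by case: h_Gamma0. Qed.
Let g_proper : eproper g. Proof. by case: g_Gamma0. Qed.

Lemma edom_argmin (w v : Hp) : Argmin (fun v => h v + (inner w v)%:E)%E v -> edom h v.
Proof.
have [[_ [v0 hv0]] _ _] := h_Gamma0.
move=> /(_ v0) /=; rewrite -(edom_fineK hN hv0) -EFinD /edom /=.
by case: (h v) => [r| |] //= _; rewrite ltry.
Qed.

Lemma iterate_succ k : x k.+1 = x k + gamma k *: (s k - x k).
Proof. by have [_ _ /(_ k)[_ _ _ -> _]] := iterates; rewrite -(opprB (s k)) scalerN opprK. Qed.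

Lemma edom_direction k : edom h (s k).
Proof. by have [_ _ /(_ k)[_ _ + _ _]] := iterates; exact: edom_argmin. Qed.

Lemma edom_iterate k : edom h (x k).
Proof.
elim: k => [|k xk]; first by case: iterates.
have /andP[g0 g1] := gamma_in01 k.
rewrite iterate_succ.
have := @econvex_fine _ _ h (x k) (s k) (gamma k) hN h_convex xk (edom_direction k).
by rewrite (ltW g0) g1 => /(_ isT)[].
Qed.

Lemma dom_g_iterate v : edom h v -> edom g (T v).
Proof.
by move=> hv; have [q /(subdifferential_edom g_proper)] := T_dom (ex_intro2 _ _ v hv erefl).
Qed.

(** The middle summand is the Moreau envelope of [g] at T x_k with parameter beta_k, expressed
    through its proximal point y_k. *)
Definition smoothed_value k : R :=
  fine (f (x k)) + (fine (g (y k)) + (2 * beta k)^-1 * `|T (x k) - y k| ^+ 2)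
  + fine (h (x k)).

(** The slope along s_k - x_k of [f] plus the envelope, whose gradient at T x_k is (T x_k - y_k) /
    beta_k, with a plain difference for the possibly nonsmooth [h]. *)
Definition direction_slope k : R :=
  inner (gradient f (x k)) (s k - x k)
  + (beta k)^-1 * inner (T (x k) - y k) (T (s k - x k))
  + (fine (h (s k)) - fine (h (x k))).

Let prox_y k : prox (fun v => (beta k)%:E * g v)%E (T (x k)) (y k).
Proof. by have [_ _ /(_ k)[]] := iterates. Qed.

Lemma residual_succ k : A (x k.+1) - b = A (x k) - b + gamma k *: A (s k - x k).
Proof. by rewrite iterate_succ linearD linearZ addrAC. Qed.

(** Three estimates add up: the descent inequality for [f], convexity of [h] along the step, and
    [moreau_change] with the old proximal point y_k as competitor at the new point; expanding the
    square there gives the gamma^2 / beta error. *)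
Lemma smoothed_value_succ k eps M DT :
  fine (f (x k.+1)) <=
    fine (f (x k)) + gamma k * inner (gradient f (x k)) (s k - x k) + eps ->
  beta k.+1 <= beta k ->
  `|min_norm (subdifferential g (T (x k.+1)))| <= M -> `|T (s k - x k)| <= DT ->
  smoothed_value k.+1 <= smoothed_value k + gamma k * direction_slope k
    + (eps + gamma k ^+ 2 / beta k * (DT ^+ 2 / 2))
    + (beta k - beta k.+1) / 2 * M ^+ 2.
Proof.
move=> hf bb qM TD.
have /andP[g0 g1] := gamma_in01 k.
have bk := beta_gt0 k.
have := @econvex_fine _ _ h (x k) (s k) (gamma k) hN h_convex (edom_iterate k) (edom_direction k).
rewrite (ltW g0) g1 -iterate_succ => /(_ isT)[_ hh].
have gy := prox_edom g_proper bk (prox_y k).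
have pq := min_normP g_proper (T_dom (ex_intro2 _ _ _ (edom_iterate k.+1) erefl)).
have bb' : 0 < beta k.+1 <= beta k by rewrite beta_gt0.
have hm : fine (g (y k.+1)) + (2 * beta k.+1)^-1 * `|T (x k.+1) - y k.+1| ^+ 2 <=
    fine (g (y k)) + (2 * beta k)^-1 * `|T (x k.+1) - y k| ^+ 2
    + (beta k - beta k.+1) / 2 * `|min_norm (subdifferential g (T (x k.+1)))| ^+ 2
  := moreau_change g_proper bk g_convex bb'
  (fun w => prox_le g_proper (beta_gt0 k.+1) (prox_y k.+1)) gy pq.
have TE : T (x k.+1) - y k = T (x k) - y k + gamma k *: T (s k - x k).
  by rewrite iterate_succ linearD linearZ addrAC.
have NE : (2 * beta k)^-1 * `|T (x k.+1) - y k| ^+ 2 =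
    (2 * beta k)^-1 * `|T (x k) - y k| ^+ 2
    + gamma k * ((beta k)^-1 * inner (T (x k) - y k) (T (s k - x k)))
    + gamma k ^+ 2 / beta k * (`|T (s k - x k)| ^+ 2 / 2).
  by rewrite TE sqr_normD innerZr sqr_normZ; field; rewrite gt_eqF.
have D2 : `|T (s k - x k)| ^+ 2 <= DT ^+ 2.
  by rewrite lerXn2r ?nnegrE ?(le_trans _ TD).
have M2 : `|min_norm (subdifferential g (T (x k.+1)))| ^+ 2 <= M ^+ 2.
  by rewrite lerXn2r ?nnegrE ?(le_trans _ qM).
have t1 : gamma k ^+ 2 / beta k * (`|T (s k - x k)| ^+ 2 / 2) <=
    gamma k ^+ 2 / beta k * (DT ^+ 2 / 2).
  by rewrite ler_wpM2l ?ler_wpM2r// divr_ge0 ?sqr_ge0// ltW.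
have t2 : (beta k - beta k.+1) / 2 * `|min_norm (subdifferential g (T (x k.+1)))| ^+ 2
    <= (beta k - beta k.+1) / 2 * M ^+ 2.
  by rewrite ler_wpM2l// divr_ge0// subr_ge0.
move: hm; rewrite NE => hm.
have := lerD (lerD hf (le_trans hm (lerD (lexx _) t2))) (lerD hh t1).
rewrite /smoothed_value /direction_slope !mulrDr.
generalize (gamma k) (fine (f (x k.+1))) (fine (f (x k))) (fine (h (x k.+1))) (fine (h (x k)))
  (fine (h (s k))) (fine (g (y k))) (fine (g (y k.+1)))
  (gamma k * inner (gradient f (x k)) (s k - x k))
  ((2 * beta k)^-1 * `|T (x k) - y k| ^+ 2)
  ((2 * beta k.+1)^-1 * `|T (x k.+1) - y k.+1| ^+ 2)
  (gamma k * ((beta k)^-1 * inner (T (x k) - y k) (T (s k - x k))))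
  (gamma k ^+ 2 / beta k * (`|T (s k - x k)| ^+ 2 / 2))
  (gamma k ^+ 2 / beta k * (DT ^+ 2 / 2))
  ((beta k - beta k.+1) / 2 * M ^+ 2).
by move=> *; lra.
Qed.

Hypothesis f_diff : forall x, edom h x -> differentiable (fine \o f) x.
Hypothesis dom_hf : edom h `<=` edom f.

(** Optimality of s_k against [xs] replaces the direction by xs - x_k; the gradient inequality for
    [f] and the subgradient (T x_k - y_k) / beta_k of [g] at y_k bound the slope, and A xs = b turns
    A (xs - x_k) into minus the residual. *)
Lemma direction_slope_le k xs : edom h xs -> edom g (T xs) -> A xs = b ->
  direction_slope k + inner (mu k) (A (s k - x k))
    + rho k * inner (A (x k) - b) (A (s k - x k)) <=
  fine (f xs) + fine (g (T xs)) + fine (h xs) - smoothed_value k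
    - inner (mu k) (A (x k) - b) - rho k * `|A (x k) - b| ^+ 2.
Proof.
move=> hxs gxs Axs.
have bk := beta_gt0 k.
have hx := edom_iterate k; have hs := edom_direction k.
have cA := bounded_linear_continuous A_bounded.
have cT := bounded_linear_continuous T_bounded.
have [_ _ /(_ k)[_ zE sE _ _]] := iterates.
have zinner w : inner (z k) w = inner (gradient f (x k)) w
    + (beta k)^-1 * inner (T (x k) - y k) (T w) + inner (mu k) (A w)
    + rho k * inner (A (x k) - b) (A w).
  rewrite zE !innerDl !innerZl ![inner (adjoint _ _) w]innerC !adjointP//.
  by rewrite ![inner (T w) _]innerC ![inner (A w) _]innerC !innerDl.
have smin : fine (h (s k)) + inner (z k) (s k) <= fine (h xs) + inner (z k) xs.
  by have := sE xs; rewrite /= -(edom_fineK hN hs) -(edom_fineK hN hxs) -!EFinD lee_fin.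
have {}smin : fine (h (s k)) + inner (z k) (s k - x k) <=
    fine (h xs) + inner (z k) (xs - x k) by rewrite !innerBr; lra.
have hf := gradient_le fN f_convex (dom_hf hx) (dom_hf hxs) (f_diff hx).
have hg := prox_subgradient g_proper bk g_convex (prox_y k) gxs.
have TE : T xs - y k = T (xs - x k) + (T (x k) - y k).
  by rewrite linearB /= addrA subrK.
have AE : A (xs - x k) = - (A (x k) - b) by rewrite linearB /= Axs opprB.
(* The proximal inequality provides the square with factor 1 / beta_k, twice what the envelope
   contains. *)
have bE : (2 * beta k)^-1 * `|T (x k) - y k| ^+ 2 <=
    (beta k)^-1 * `|T (x k) - y k| ^+ 2.
  rewrite ler_wpM2r ?sqr_ge0// lef_pV2 ?posrE ?mulr_gt0//; lra.
have {}hg : fine (g (y k)) + ((beta k)^-1 * inner (T (x k) - y k) (T (xs - x k))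
    + (beta k)^-1 * `|T (x k) - y k| ^+ 2) <= fine (g (T xs)).
  by move: hg; rewrite TE innerDr inner_norm mulrDr.
have {}smin : fine (h (s k)) + (inner (gradient f (x k)) (s k - x k)
    + (beta k)^-1 * inner (T (x k) - y k) (T (s k - x k))
    + inner (mu k) (A (s k - x k)) + rho k * inner (A (x k) - b) (A (s k - x k))) <=
    fine (h xs) + (inner (gradient f (x k)) (xs - x k)
    + (beta k)^-1 * inner (T (x k) - y k) (T (xs - x k))
    - inner (mu k) (A (x k) - b) - rho k * `|A (x k) - b| ^+ 2).
  by move: smin; rewrite !zinner AE !innerNr inner_norm mulrN.
move: hf hg bE smin; rewrite /smoothed_value /direction_slope.
generalize (fine (f (x k))) (fine (f xs)) (fine (h xs)) (fine (h (x k)))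
  (fine (h (s k))) (fine (g (y k))) (fine (g (T xs)))
  (inner (gradient f (x k)) (s k - x k)) (inner (gradient f (x k)) (xs - x k))
  ((2 * beta k)^-1 * `|T (x k) - y k| ^+ 2)
  ((beta k)^-1 * `|T (x k) - y k| ^+ 2)
  ((beta k)^-1 * inner (T (x k) - y k) (T (xs - x k)))
  ((beta k)^-1 * inner (T (x k) - y k) (T (s k - x k)))
  (inner (mu k) (A (s k - x k))) (inner (mu k) (A (x k) - b))
  (rho k * inner (A (x k) - b) (A (s k - x k))) (rho k * `|A (x k) - b| ^+ 2).
by move=> *; lra.
Qed.

Lemma smoothed_value_ge k M :
  `|min_norm (subdifferential g (T (x k)))| <= M ->
  fine (f (x k)) + fine (g (T (x k))) + fine (h (x k)) <=
  smoothed_value k + beta k / 2 * M ^+ 2.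
Proof.
move=> qM.
have pq := min_normP g_proper (T_dom (ex_intro2 _ _ _ (edom_iterate k) erefl)).
have hm := moreau_ge g_proper (beta_gt0 k) (prox_y k) pq.
have M2 : beta k / 2 * `|min_norm (subdifferential g (T (x k)))| ^+ 2 <=
    beta k / 2 * M ^+ 2.
  by rewrite ler_wpM2l ?lerXn2r ?nnegrE ?(le_trans _ qM)// divr_ge0// ltW.
rewrite /smoothed_value; lra.
Qed.

End feasibility.

Theorem theorem4p1 (R : realType) (Hp Hd Hv : hilbertType R)
  (A : {linear Hp -> Hd}) (A_bounded : bounded_near A (nbhs (0 : Hp)))
  (T : {linear Hp -> Hv}) (T_bounded : bounded_near T (nbhs (0 : Hp)))
  (b : Hd) (f h : Hp -> \bar R) (g : Hv -> \bar R)
  (f_Gamma0 : Gamma0 f) (g_Gamma0 : Gamma0 g) (gT_Gamma0 : Gamma0 (g \o T))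
  (h_Gamma0 : Gamma0 h)
  (F : Hp -> \bar R) (F_gtNy : forall x, (-oo < F x)%E)
  (zeta : R -> R) (zeta_ge0 : forall t, 0 < t <= 1 -> 0 <= zeta t)
  (f_smooth : smooth_pair F zeta f (edom h))
  (dom_h_compact : weakly_compact (edom h))
  (T_dom : T @` edom h `<=` dom_subdifferential g)
  (subdiff_bounded :
     (ereal_sup [set (`|min_norm (subdifferential g (T x))|)%:E
                | x in edom h] < +oo)%E)
  (saddle : exists (xs : Hp) (mus : Hd), saddle_point f h g A T b xs mus)
  (gamma beta theta rho : R^nat)
  (nonneg : forall k, [/\ 0 <= gamma k, 0 < beta k, 0 <= theta k & 0 <= rho k])
  (gamma_in01 : forall k, 0 < gamma k <= 1)
  (zeta_gamma_ell1 : ell1_plus (fun k => zeta (gamma k)))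
  (gamma2_beta_ell1 : ell1_plus (fun k => gamma k ^+ 2 / beta k))
  (gamma_beta_ell1 : ell1_plus (fun k => gamma k * beta k))
  (gamma_not_ell1 : ~ ell1 gamma)
  (beta_nonincr : nonincreasing_seq beta) (beta_cvg0 : beta @ \oo --> 0)
  (rho_nondecr : nondecreasing_seq rho)
  (rho_inf_gt0 : 0 < inf (range rho)) (rho_bounded : has_ubound (range rho))
  (Mlo Mhi : R) (Mlo_gt0 : 0 < Mlo) (Mhi_gt0 : 0 < Mhi)
  (ratio_ge : (Mlo%:E <=
     ereal_inf (range (fun k => (gamma k / gamma k.+1)%:E)))%E)
  (ratio_le : (ereal_sup (range (fun k => (gamma k / gamma k.+1)%:E))
     <= Mhi%:E)%E)
  (c : R) (c_gt0 : 0 < c) (theta_def : forall k, theta k = gamma k / c)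
  (c_large : Mhi / c - inf (range rho) / 2 < 0)
  (x : nat -> Hp) (mu : nat -> Hd) (y : nat -> Hv) (z s : nat -> Hp)
  (iterates : algorithm f h g A T b gamma beta theta rho x mu y z s) :
  [/\ (fun k => A (x k)) @ \oo --> b,
      (fun k => inf [set `|A (x i) - b| | i in [set i | (i <= k)%N]])
        =O_\oo (fun k => (Num.sqrt (psum gamma k))^-1),
      (exists phi : nat -> nat, {homo phi : i j / (i < j)%N} /\
        forall j, `|A (x (phi j)) - b| <= (Num.sqrt (psum gamma (phi j)))^-1)
    & (fun k => `|A (ergodic gamma x k) - b|)
        =O_\oo (fun k => (Num.sqrt (psum gamma k))^-1)].
Proof.
have g_proper : eproper g by case: g_Gamma0.
have fN u : (-oo < f u)%E by case: f_Gamma0 => -[].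
have hN u : (-oo < h u)%E by case: h_Gamma0 => -[].
have gN v : (-oo < g v)%E by case: g_proper.
have h_convex : econvex h by case: h_Gamma0.
have beta_gt0 k : 0 < beta k by case: (nonneg k).
have gamma_gt0 k : 0 < gamma k by case/andP: (gamma_in01 k).
have gamma_ge0 k : 0 <= gamma k by exact: ltW.
have dom_hf : edom h `<=` edom f by case: f_smooth.
have f_diff u : edom h u -> differentiable (fine \o f) u.
  by case: f_smooth => _ [C0 [_ [hC0 _] dC0 _ _]] /hC0/dC0[_ []].
have dom_h_segment u v t : edom h u -> edom h v -> 0 <= t <= 1 ->
    edom h (u + t *: (v - u)).
  by move=> hu hv t01; have [] := econvex_fine hN h_convex hu hv t01.
have [K K0 descent] := smooth_pair_descent zeta_ge0 dom_h_segment f_smooth.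
have xC := edom_iterate h_Gamma0 gamma_in01 iterates.
have sC := edom_direction h_Gamma0 iterates.
have [Mx hMx] := weakly_compact_bounded dom_h_compact.
have [LA LA0 hLA] := continuous_linear_bound A_bounded.
have [LT LT0 hLT] := continuous_linear_bound T_bounded.
have [M hM] : exists M, forall u, edom h u -> `|min_norm (subdifferential g (T u))| <= M.
  eexists => u hu; rewrite -lee_fin; apply: le_trans (le_max0_fine subdiff_bounded).
  by apply: ereal_sup_ubound; exists u.
have [xs [mus sp]] := saddle.
have gT := dom_g_iterate g_Gamma0 T_dom.
have [fxs hxs gxs Axs sp_le] := saddle_pointP fN hN gN (dom_hf _ (xC 0%N)) (xC 0%N)
  (gT _ (xC 0%N)) sp.
set Phi := fine (f xs) + _ + _ in sp_le.
pose e k := A (x k) - b.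
(* The domain of [h] lies in a ball of radius [Mx], so residuals and step directions are uniformly
   bounded. *)
pose B := LA * Mx + `|b|.
pose DA := LA * (2 * Mx).
pose DT := LT * (2 * Mx).
have eB k : `|e k| <= B.
  apply: le_trans (ler_normB _ _) _; rewrite lerD2r.
  by apply: le_trans (hLA _) _; rewrite ler_wpM2l ?hMx.
have dM k : `|s k - x k| <= 2 * Mx.
  by apply: le_trans (ler_normB _ _) _; rewrite mulr_natl mulr2n lerD ?hMx.
have adD k : `|A (s k - x k)| <= DA by apply: le_trans (hLA _) _; rewrite ler_wpM2l.
have tdD k : `|T (s k - x k)| <= DT by apply: le_trans (hLT _) _; rewrite ler_wpM2l.
have eS k : e k.+1 = e k + gamma k *: A (s k - x k) := residual_succ iterates k.
pose rhomax := sup (range rho).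
have rho_le k : rho k <= rhomax by apply: ub_le_sup => //; exists k.
have rho01 k : 0 <= rho k <= rhomax by rewrite rho_le andbT; case: (nonneg k).
have rhomax0 : 0 <= rhomax by apply: le_trans (rho_le 0%N); case: (nonneg 0%N).
have rho_ge k : inf (range rho) <= rho k.
  apply: ge_inf; last by exists k.
  by exists 0 => _ [i _ <-]; case: (nonneg i).
pose S := smoothed_value T f h g beta x y.
pose U k := lyapunov c M B rhomax Phi (S k) (beta k) (rho k) (e k) (mu k - mus) mus.
have Phi_le k : Phi <= S k + beta k / 2 * M ^+ 2 + inner mus (e k).
  apply: le_trans (sp_le _ (dom_hf _ (xC k)) (xC k) (gT _ (xC k))) _.
  rewrite lerD2r.
  exact: (smoothed_value_ge g_Gamma0 h_Gamma0 T_dom gamma_in01 beta_gt0 iterates (hM _ (xC k))).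
pose C1 := 2 / c + (rhomax * DA ^+ 2 / 2 + (B ^+ 2 + 2 * DA ^+ 2) / c + DA ^+ 2 / 2
        + B ^+ 2 / (2 * c)).
(* The relative error of one step: its pieces are summable by the assumptions on zeta(gamma),
   gamma^2 / beta and gamma beta, and by [b4] for gamma^2. *)
pose w k := (K * zeta (gamma k) + gamma k ^+ 2 / beta k * (DT ^+ 2 / 2))
  + gamma k * beta k * (M ^+ 2 / 2) + gamma k ^+ 2 * C1.
have muS k : mu k.+1 - mus = (mu k - mus) + (gamma k / c) *: e k.+1.
  by have [_ _ /(_ k)[_ _ _ _ ->]] := iterates; rewrite theta_def addrAC.
have r0 k : 0 <= K * zeta (gamma k) + gamma k ^+ 2 / beta k * (DT ^+ 2 / 2).
  apply: addr_ge0; first by rewrite mulr_ge0 ?zeta_ge0.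
  by rewrite mulr_ge0 ?divr_ge0 ?sqr_ge0 ?(ltW (beta_gt0 k)).
have step k : U k.+1 + (rho k - c^-1) * (gamma k * `|e k| ^+ 2) <= (1 + w k) * U k.
  have bb : beta k.+1 <= beta k by exact: beta_nonincr.
  pose D := direction_slope T f h beta x y s k.
  have := @lyapunov_step _ _ c M B DA rhomax Phi c_gt0 rhomax0 (S k) (S k.+1)
    (beta k) (beta k.+1) (rho k) (rho k.+1) (gamma k) D _ (e k) (A (s k - x k))
    (mu k - mus) mus (ltW (beta_gt0 k)) (rho01 k) _ (gamma_in01 k) (eB k) _ (adD k) (r0 k).
  rewrite -eS -muS; apply.
  - exact: rho_nondecr.
  - exact: eB.
  - apply: (smoothed_value_succ g_Gamma0 h_Gamma0 T_dom gamma_in01 beta_gt0 iterates _ bb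
      (hM _ (xC _)) (tdD k)).
    rewrite (iterate_succ iterates); exact: descent.
  - rewrite subrK.
    exact: (direction_slope_le A_bounded T_bounded f_Gamma0 g_Gamma0 h_Gamma0 gamma_in01
      beta_gt0 iterates f_diff dom_hf _ hxs gxs Axs).
  - exact: Phi_le.
have gamma2_le k : gamma k ^+ 2 <= beta 0%N * (gamma k ^+ 2 / beta k).
  rewrite mulrA ler_pdivlMr// mulrC ler_wpM2r ?sqr_ge0//.
  exact: beta_nonincr.
have b1 := ell1_plus_bounded_sums zeta_gamma_ell1.
have b2 := ell1_plus_bounded_sums gamma2_beta_ell1.
have b3 := ell1_plus_bounded_sums gamma_beta_ell1.
have b4 : bounded_sums (fun k => gamma k ^+ 2).
  by apply: (le_bounded_sums gamma2_le); apply: bounded_sumsZ => //; exact: ltW.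
have C10 : 0 <= C1.
  have ci : 0 <= c by exact: ltW.
  have DA2 : 0 <= DA ^+ 2 by exact: sqr_ge0.
  have B2 : 0 <= B ^+ 2 by exact: sqr_ge0.
  apply: addr_ge0; first by rewrite divr_ge0.
  apply: addr_ge0; last by rewrite divr_ge0// mulr_ge0.
  apply: addr_ge0; last by rewrite divr_ge0.
  apply: addr_ge0; last by rewrite divr_ge0// addr_ge0// mulr_ge0.
  by rewrite divr_ge0// mulr_ge0.
have bw : bounded_sums w.
  rewrite /w; apply: bounded_sumsD; last first.
    under eq_fun do rewrite mulrC; exact: bounded_sumsZ.
  apply: bounded_sumsD; last first.
    by under eq_fun do rewrite mulrC; apply: bounded_sumsZ; rewrite ?divr_ge0 ?sqr_ge0.
  apply: bounded_sumsD; first exact: bounded_sumsZ.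
  by under eq_fun do rewrite mulrC; apply: bounded_sumsZ; rewrite ?divr_ge0 ?sqr_ge0.
(* With Mhi >= 1, [c_large] gives 1 / c <= Mhi / c < del, half the infimum of rho, so that rho_k - 1
   / c >= del > 0. *)
have Mhi1 : 1 <= Mhi.
  apply: (one_le_ratio gamma_gt0 b4) => k.
  rewrite -ler_pdivrMr// -lee_fin; apply: le_trans ratio_le.
  by apply: ereal_sup_ubound; exists k.
set del := inf (range rho) / 2 in c_large.
have del0 : 0 < del by rewrite divr_gt0.
have rho_del k : del <= rho k - c^-1.
  have : c^-1 <= Mhi / c by rewrite ler_peMl// invr_ge0 ltW.
  have : inf (range rho) = del + del by rewrite /del; field.
  have := rho_ge k; lra.
have bge : bounded_sums (fun k => gamma k * `|e k| ^+ 2).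
  have v0 k : 0 <= gamma k * `|e k| ^+ 2 by rewrite mulr_ge0 ?sqr_ge0.
  apply: (@le_bounded_sums _ _ (fun k => del^-1 * ((rho k - c^-1) * (gamma k * `|e k| ^+ 2)))).
    by move=> k; rewrite ler_pdivlMl// ler_wpM2r.
  apply: bounded_sumsZ; first by rewrite invr_ge0 ltW.
  apply: (bounded_sums_quasi_fejer (u := U) _ _ _ bw step) => k.
  - apply: le_trans (lyapunov_ge c_gt0 (mu k - mus) (rho01 k) (eB k) (Phi_le k)).
    by rewrite addr_ge0// mulr_ge0 ?sqr_ge0// divr_ge0// ltW.
  - apply: addr_ge0; last by rewrite mulr_ge0 ?sqr_ge0.
    apply: addr_ge0; first exact: r0.
    apply: mulr_ge0; last by rewrite divr_ge0 ?sqr_ge0.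
    by apply: mulr_ge0 => //; exact: ltW.
  - by rewrite mulr_ge0// (le_trans _ (rho_del k))// ltW.
have gunb := not_ell1_unbounded gamma_ge0 gamma_not_ell1.
have G0 k : 0 < psum gamma k.
  by rewrite /psum big_nat_recr//= ltr_wpDl// sumr_ge0.
have [Be Be0 hBe] := bounded_sums_ge0 bge.
(* The weighted mean of the residual norms dominates both the smallest of them and the residual norm
   of the ergodic mean, so this one bound gives both rates. *)
have mean k : (psum gamma k)^-1 * \sum_(0 <= i < k.+1) gamma i * `|e i| <=
    (Be + 1) / 2 * (Num.sqrt (psum gamma k))^-1.
  have s0 : 0 < Num.sqrt (psum gamma k) by rewrite sqrtr_gt0.
  rewrite ler_pdivrMl//; apply: le_trans (series_le_sqrt_psum gamma_gt0 (hBe k.+1)) _.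
  rewrite mulrCA ler_wpM2l//.
    by rewrite divr_ge0// addr_ge0.
  by rewrite ler_pdivlMr// -expr2 sqr_sqrtr// ltW.
have Bep : 0 < (Be + 1) / 2 by rewrite divr_gt0// ltr_wpDl.
have sqrtV_ge0 k : 0 <= (Num.sqrt (psum gamma k))^-1 by rewrite invr_ge0 sqrtr_ge0.
split.
- apply/cvgrPdist_lt => eps eps0.
  (* Consecutive residuals differ by gamma_k A (s_k - x_k), so their norms vary slowly, with L =
     [DA]. *)
  have e_cvg : (fun k => `|e k|) @ \oo --> (0 : R).
    apply: (cvg0_of_bounded_sums_sqr (L := DA) _ _ gunb _ b4 bge) => k //.
      by rewrite gamma_ge0; case/andP: (gamma_in01 k).
    apply: le_trans (ler_dist_dist _ _) _.
    by rewrite eS addrAC subrr add0r normrZ ger0_norm// mulrC ler_wpM2r.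
  have /cvgrPdist_lt/(_ _ eps0) := e_cvg; apply: filterS => k.
  by rewrite sub0r normrN normr_id /e distrC.
- apply/eqO_exP; exists ((Be + 1) / 2) => //; apply: nearW => k.
  rewrite [X in _ <= _ * X]ger0_norm//; apply: le_trans (mean k).
  set I := inf _.
  have Ile i : (i <= k)%N -> I <= `|e i|.
    by move=> ik; apply: ge_inf; [exists 0 => _ [j _ <-]|exists i].
  have I0 : 0 <= I by apply: lb_le_inf; [exists `|e 0%N|, 0%N|move=> _ [j _ <-]].
  rewrite ger0_norm// ler_pdivlMl// /psum mulr_suml big_nat [leRHS]big_nat.
  by apply: ler_sum => i /andP[_ ik]; rewrite ler_wpM2l// Ile.
(* The constant 1 is met at arbitrarily large ranks by the Abel-Dini argument, whatever the size of
   [Be]. *)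
- apply: (@increasing_subsequence
    (fun k => `|A (x k) - b| <= (Num.sqrt (psum gamma k))^-1)) => N.
  exact: (frequently_le_sqrt_psum gamma_gt0 _ gunb bge).
- apply/eqO_exP; exists ((Be + 1) / 2) => //; apply: nearW => k.
  rewrite [X in _ <= _ * X]ger0_norm// normr_id; apply: le_trans (mean k).
  rewrite ergodicB ?gt_eqF// normrZ ger0_norm ?invr_ge0 ?(ltW (G0 k))//.
  rewrite ler_wpM2l ?invr_ge0 ?(ltW (G0 k))//.
  apply: le_trans (ler_norm_sum _ _ _) _; apply: ler_sum => i _.
  by rewrite normrZ ger0_norm.
Qed.
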